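(* Let $F$ be an interpolation Banach lattice between $L^\infty$ and $L^\infty(1/t)$ on $[0,1]$. The following conditions are equivalent: (i) the operator $Tf(t)=f(t^2)/t$ is bounded on $F$; (ii) for all ordered pairs $\vec A=(A_0,A_1)$, and for all $0<\theta<1$ and $1\le q\le\infty$, we have $\langle\vec A_{\theta,q},A_1\rangle_F^K=\langle\vec A\rangle_F^K$ (with constants depending on $\theta$ and $q$); (iii) for every ordered pair $\vec A=(A_0,A_1)$ there exist $\theta_1,\theta_2\in(0,1)$, $\theta_1\ne\theta_2$, and $1\le q_1,q_2\le\infty$ such that $\langle\vec A_{\theta_1,q_1},A_1\rangle_F^K=\langle\vec A_{\theta_2,q_2},A_1\rangle_F^K$; (iv) there exist $\theta_1,\theta_2\in(0,1)$, $\theta_1\ne\theta_2$, and $1\le q_1,q_2\le\infty$ such that $$\langle(L^1,L^\infty)_{\theta_1,q_1},L^\infty\rangle_F^K=\langle(L^1,L^\infty)_{\theta_2,q_2},L^\infty\rangle_F^K .$$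
   Context: A Banach pair $\vec A=(A_0,A_1)$ consists of two Banach spaces continuously embedded in a common Hausdorff topological vector space; it is ordered if $A_1\subset A_0$ with embedding of norm at most $1$. $K(t,x;\vec A)=\inf\{\Vert a_0\Vert_{A_0}+t\Vert a_1\Vert_{A_1}: x=a_0+a_1,\ a_i\in A_i\}$. $L^p=L^p[0,1]$ (Lebesgue measure) and $\Vert f\Vert_{L^\infty(1/t)}=\Vert f(t)/t\Vert_{L^\infty}$. A Banach lattice $F$ of measurable functions on $[0,1]$ is an interpolation lattice between $L^\infty$ and $L^\infty(1/t)$ if $L^\infty(1/t)\subset F\subset L^\infty$ continuously and every linear operator bounded on both $L^\infty$ and $L^\infty(1/t)$ is bounded on $F$. For a Banach pair $\vec B=(B_0,B_1)$, $\langle B_0,B_1\rangle_F^K=\langle\vec B\rangle_F^K=\{x\in B_0+B_1:\Vert K(\cdot,x;\vec B)\Vert_F<\infty\}$ with this norm (the $K$-functional is regarded as a function on $[0,1]$). $\vec A_{\theta,q}=(A_0,A_1)_{\theta,q}$ is the classical Lions–Peetre real interpolation space, with norm $\left(\int_0^\infty(s^{-\theta}K(s,x;\vec A))^q\frac{ds}{s}\right)^{1/q}$ (supremum if $q=\infty$). Equalities of spaces are understood with equivalence of norms. *)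

(* Defs.v *)
(* All scalars are real. *)
From HB Require Import structures.
From mathcomp Require Import all_boot all_order all_algebra.
From mathcomp Require Import all_classical all_reals all_analysis.

Set Implicit Arguments.
Unset Strict Implicit.
Unset Printing Implicit Defensive.

Import Order.TTheory GRing.Theory Num.Theory.
Import numFieldNormedType.Exports.

Local Open Scope classical_set_scope.
Local Open Scope ring_scope.
Local Open Scope ereal_scope.

(* A normed space contained in a vector space V is represented by its extended
   norm on V, equal to +oo off the space.  The space itself is thus
   [set x | N x < +oo]. *)

Section extended_norms.
Context {R : realType}.

(* Equality of spaces with equivalence of norms: since 0 < C, either estimate
   forces an inclusion of the sets where the norms are finite. *)
Definition norm_equiv_with (V : Type) (C : R) (N N' : V -> \bar R) : Prop :=
  (0 < C)%R /\ forall x, N x <= C%:E * N' x /\ N' x <= C%:E * N x.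

Definition norm_equiv (V : Type) (N N' : V -> \bar R) : Prop :=
  exists C : R, norm_equiv_with C N N'.

Definition bounded_on (V : Type) (N : V -> \bar R) (T : V -> V) : Prop :=
  exists C : R, forall x, N x < +oo -> N (T x) <= C%:E * N x.

Context {V : zmodType}.

Definition in_sum (N0 N1 : V -> \bar R) (x : V) : Prop :=
  exists a0 a1 : V, [/\ N0 a0 < +oo, N1 a1 < +oo & x = (a0 + a1)%R].

Definition K_functional (N0 N1 : V -> \bar R) (t : R) (x : V) : \bar R :=
  ereal_inf [set k | exists a0 a1 : V,
    [/\ N0 a0 < +oo, N1 a1 < +oo, x = (a0 + a1)%R &
        k = N0 a0 + t%:E * N1 a1]].

(* Only used for 1 <= q, so that the last case is q = +oo. *)
Definition real_interpolation_norm (N0 N1 : V -> \bar R) (theta : R)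
    (q : \bar R) (x : V) : \bar R :=
  match q with
  | p%:E =>
      (\int[lebesgue_measure]_(s in `]0%R, +oo[)
        (((s `^ (- theta))%:E * K_functional N0 N1 s x) `^ p * (s^-1)%:E))
      `^ p^-1
  | _ => ereal_sup [set (s `^ (- theta))%:E * K_functional N0 N1 s x
                   | s in `]0%R, +oo[]
  end.

End extended_norms.

Section banach_pairs.
Context {R : realType}.

Record banach_pair := BanachPair {
  pair_ambient : topologicalLmodType R ;
  pair_hausdorff : hausdorff_space pair_ambient ;
  pair_space0 : completeNormedModType R ;
  pair_space1 : completeNormedModType R ;
  pair_emb0 : {linear pair_space0 -> pair_ambient} ;
  pair_emb1 : {linear pair_space1 -> pair_ambient} ;
  pair_inj0 : injective pair_emb0 ;
  pair_inj1 : injective pair_emb1 ;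
  pair_cont0 : continuous pair_emb0 ;
  pair_cont1 : continuous pair_emb1
}.

Definition ordered_pair (A : banach_pair) : Prop :=
  forall a1 : pair_space1 A, exists2 a0 : pair_space0 A,
    pair_emb0 A a0 = pair_emb1 A a1 & (`|a0| <= `|a1|)%R.

(* The set below has at most one element when j is injective, and its infimum
   is +oo when x is not in the range of j. *)
Definition embedded_norm (B : normedModType R) (V : Type) (j : B -> V) (x : V)
  : \bar R := ereal_inf [set (`|a|)%:E | a in j @^-1` [set x]].

Definition pair_norm0 (A : banach_pair) : pair_ambient A -> \bar R :=
  embedded_norm (pair_emb0 A).

Definition pair_norm1 (A : banach_pair) : pair_ambient A -> \bar R :=
  embedded_norm (pair_emb1 A).

End banach_pairs.
Arguments banach_pair R : clear implicits.
Arguments pair_norm0 {R} A _.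
Arguments pair_norm1 {R} A _.

(* Functions on [0, 1] are represented by functions R -> R whose values off
   [0, 1] are irrelevant, and are identified when equal a.e. on [0, 1]. *)

Section lattices.
Context (R : realType).

Definition leb01 : {measure set (measurableTypeR R) -> \bar R} :=
  mrestr lebesgue_measure (measurable_itv `[0%R : R, 1%R]).

Definition measurable01 (f : R -> R) : Prop :=
  measurable_fun `[0%R : R, 1%R] f.

Definition Lp01_norm (p : \bar R) (f : R -> R) : \bar R :=
  if `[< measurable01 f >] then 'N[leb01]_p[EFin \o f] else +oo.

Definition L1_norm : (R -> R) -> \bar R := Lp01_norm 1.

Definition Linfty_norm : (R -> R) -> \bar R := Lp01_norm +oo.

Definition Linfty_inv_norm (f : R -> R) : \bar R :=
  Linfty_norm (fun t => f t / t)%R.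

Record banach_lattice01 := BanachLattice01 {
  lattice_norm :> (R -> R) -> \bar R ;
  lattice_measurable : forall f, lattice_norm f < +oo -> measurable01 f ;
  lattice_ge0 : forall f, 0 <= lattice_norm f ;
  lattice_eq0 : forall f, lattice_norm f = 0 -> f = (cst 0%R) %[ae leb01] ;
  lattice_scale : forall (a : R) f,
    lattice_norm (fun t => a * f t)%R = (`|a|)%:E * lattice_norm f ;
  lattice_add : forall f g,
    lattice_norm (f + g)%R <= lattice_norm f + lattice_norm g ;
  lattice_ideal : forall f g, measurable01 f ->
    (\forall t \ae leb01, (`|f t| <= `|g t|)%R) ->
    lattice_norm f <= lattice_norm g ;
  lattice_complete : forall u : nat -> R -> R,
    (forall n, lattice_norm (u n) < +oo) ->
    (forall e : R, (0 < e)%R ->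
      exists n0, forall m n, (n0 <= m)%N -> (n0 <= n)%N ->
        lattice_norm (u m - u n)%R < e%:E) ->
    exists2 f, lattice_norm f < +oo &
      (fun n => lattice_norm (u n - f)%R) @ \oo --> 0
}.

(* An operator acting on a.e. classes is represented by a map on
   representatives, so it is linear up to a.e. equality. *)
Definition linear_on_Linfty (T : (R -> R) -> (R -> R)) : Prop :=
  forall (a : R) f g, Linfty_norm f < +oo -> Linfty_norm g < +oo ->
    T (fun t => a * f t + g t)%R = (fun t => a * T f t + T g t)%R %[ae leb01].

(* L^oo(1/t) is contained in L^oo, so an operator bounded on both spaces is a
   bounded operator on L^oo whose restriction to L^oo(1/t) is bounded. *)
Definition interpolation_lattice (F : banach_lattice01) : Prop :=
  [/\ exists C : R, forall f,
        Linfty_inv_norm f < +oo -> F f <= C%:E * Linfty_inv_norm f,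
      exists C : R, forall f, F f < +oo -> Linfty_norm f <= C%:E * F f &
      forall T : (R -> R) -> (R -> R), linear_on_Linfty T ->
        bounded_on Linfty_norm T -> bounded_on Linfty_inv_norm T ->
        bounded_on F T].

(* For x in the sum space, K_functional N0 N1 t x is finite for all t in
   [0, 1], so that fine loses no information there. *)
Definition K_method_norm (F : banach_lattice01) (V : zmodType)
    (N0 N1 : V -> \bar R) (x : V) : \bar R :=
  if `[< in_sum N0 N1 x >] then F (fun t => fine (K_functional N0 N1 t x))
  else +oo.

Definition interpolated_K_method_norm (F : banach_lattice01) (V : zmodType)
    (N0 N1 : V -> \bar R) (theta : R) (q : \bar R) : V -> \bar R :=
  K_method_norm F (real_interpolation_norm N0 N1 theta q) N1.

Definition square_operator (f : R -> R) : R -> R :=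
  (fun t => f (t ^+ 2) / t)%R.

End lattices.
Arguments square_operator {R} f _.
Arguments L1_norm {R} f.
Arguments Linfty_norm {R} f.

(* Main.v *)
(* For eta quasi-concave on (0, 1], put T_a eta(t) = t^(1-a) eta(t^a); then
   T_a T_b = T_(ab), T_2 is the operator T of (i), and T_a eta increases with a.

   Every f in F has a quasi-concave majorant whose norm in F is controlled by
   that of f: some majorant is at most 2 S|f| for a positive linear operator
   S = S_f bounded on L^oo and L^oo(1/t), and a gliding hump argument makes the
   constant uniform.

   Let phi = K(., x; A_0, A_1), psi = K(., x; A_(theta,q), A_1) and
   a = 1 / (1 - theta).  Then T_a phi <= 4 psi, while psi <= C eta for every
   quasi-concave eta >= T_a' phi with a' > a (a weak form of Holmstedt's formula).
   If T is bounded on F, iterating it bounds all T_a on quasi-concave functions,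
   and the norms of phi and psi in F are equivalent.  Conversely, given an
   equivalence for theta1 < theta2, choose theta' strictly between them; for
   quasi-concave eta, if phi is equivalent to T_(1-theta') eta, then psi for
   theta1 is at most C eta and psi for theta2 is at least c T_a eta with
   a = (1 - theta') / (1 - theta2) > 1; iterating yields (i).  Such x exist for the
   couple (L^1, L^oo) and for bounded functions with a weight.  The latter pair
   serves to deduce (i) from (iii), which avoids the completeness of L^1; (iv)
   then follows from (i) because the estimates hold for seminorms. *)
Require Import Defs.
From HB Require Import structures.
From mathcomp Require Import all_boot all_order all_algebra.
From mathcomp Require Import all_classical all_reals all_analysis.
From mathcomp Require Import measurable_realfun ess_sup_inf zify ring lra.

Set Implicit Arguments.
Unset Strict Implicit.
Unset Printing Implicit Defensive.

Import Order.TTheory GRing.Theory Num.Theory.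
Import numFieldNormedType.Exports.

Local Open Scope classical_set_scope.
Local Open Scope ring_scope.

(** * Quasi-concave functions and their dilations *)

Section quasiconcave_functions.
Context {R : realType}.
Implicit Types (f g : R -> R) (a b s t : R).

(** The main obstacle is that the interpolation property of F concerns linear operators, one at a
    time and each with its own constant, whereas passing to a quasi-concave majorant is not linear.
    The linearisation has to be adapted to f: the sets over which averages are taken are chosen from
    f, hence so is the bound on the majorant. Completeness of F is what turns these separate bounds
    into a uniform one. Holmstedt's upper bound for psi contains an integral over (0, t^a). Raising
    theta to theta' leaves a factor s^(theta' - theta) that makes this integral converge, so that a
    pointwise bound on K suffices. The loss is harmless when T is bounded, because one a > 1 already
    controls all the others; in the converse direction the room for it is the gap between theta1 and
    theta2. *)

Definition quasiconcave f : Prop := forall s t, 0 < s -> s <= t -> t <= 1 ->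
  [/\ 0 <= f s, f s <= f t & s * f t <= t * f s].

Lemma quasiconcave_ge0 f t : quasiconcave f -> 0 < t <= 1 -> 0 <= f t.
Proof. by move=> qf /andP[t0 t1]; have [] := qf t t t0 (lexx t) t1. Qed.

Lemma quasiconcave_scale f a : 0 <= a -> quasiconcave f ->
  quasiconcave (fun t => a * f t).
Proof.
move=> a0 qf s t s0 st t1; have [f0 fst sft] := qf s t s0 st t1; split.
- exact: mulr_ge0.
- exact: ler_wpM2l.
- by rewrite !(mulrCA _ a); exact: ler_wpM2l.
Qed.

Lemma quasiconcave_measurable f : quasiconcave f -> measurable01 f.
Proof.
(* g is a monotone extension to the whole line; f itself is unconstrained at 0, which is split off
   as a singleton. *)
move=> qf; pose g t := if t <= 0 then 0 else if t <= 1 then f t else f 1.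
have g_nd : {homo g : s t / s <= t}.
  move=> s t st; rewrite /g; case: (leP s 0) => s0; case: (leP t 0) => t0 //.
  - case: (leP t 1) => t1; apply: (quasiconcave_ge0 qf); first by rewrite t0.
    by rewrite ltr01 lexx.
  - by move: (lt_le_trans s0 st); rewrite ltNge t0.
  - case: (leP s 1) => s1; case: (leP t 1) => t1 //.
    + by have [] := qf s t s0 st t1.
    + by have [] := qf s 1 s0 s1 (lexx 1).
    + by move: (le_lt_trans t1 s1); rewrite ltNge st.
have mg : measurable_fun (`[0, 1] : set R) g.
  by apply: nondecreasing_measurable => // s t _ _; exact: g_nd.
have -> : measurable01 f = measurable_fun (`[0, 1] : set R) f by [].
have -> : `[0, 1]%classic = [set 0] `|` `]0, 1]%classic :> set R.
  by rewrite setU1itv ?bnd_simp// ler01.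
apply/measurable_funU => //; split; first exact: measurable_fun_set1.
apply: (@eq_measurable_fun _ _ _ _ _ g).
  move=> t; rewrite inE/= in_itv/= => /andP[t0 t1].
  by rewrite /g leNgt t0 /= t1.
by apply: measurable_funS mg => //; apply: subset_itvr; rewrite bnd_simp.
Qed.

Lemma measurable_fun_invr (D : set R) : measurable D -> D `<=` `[0, +oo[ ->
  measurable_fun D (fun t => t^-1).
Proof.
move=> mD D0; apply: (@eq_measurable_fun _ _ _ _ _ (fun t : R => t `^ (- 1))).
  by move=> t /set_mem/D0 /=; rewrite in_itv/= andbT => /powR_inv1 ->.
apply: measurable_funTS; exact: measurable_powR.
Qed.

Definition power_dilation a f t : R := t `^ (1 - a) * f (t `^ a).

Lemma powR_itv01 a t : 0 <= a -> 0 < t <= 1 -> 0 < t `^ a <= 1.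
Proof.
move=> a0 /andP[t0 t1]; rewrite powR_gt0//=.
rewrite [leRHS](_ : 1 = 1 `^ a); last by rewrite powR1.
by apply: ge0_ler_powR => //; rewrite nnegrE ltW.
Qed.

Lemma power_dilationE a f t : 0 < t ->
  power_dilation a f t = t * (t `^ a)^-1 * f (t `^ a).
Proof.
move=> t0; rewrite /power_dilation powRB ?(gt_eqF t0) ?implybT//.
by rewrite powRr1 ?ltW.
Qed.

Lemma power_dilation_comp a b f t : 0 < t ->
  power_dilation a (power_dilation b f) t = power_dilation (a * b) f t.
Proof.
move=> t0; rewrite /power_dilation -!powRrM mulrA -powRD; last first.
  by rewrite (gt_eqF t0) implybT.
by congr (_ `^ _ * _); ring.
Qed.

Lemma power_dilation1 f t : 0 < t -> power_dilation 1 f t = f t.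
Proof. by move=> t0; rewrite /power_dilation subrr powRr0 mul1r powRr1 ?ltW. Qed.

Lemma power_dilation2 f t : 0 < t -> power_dilation 2 f t = square_operator f t.
Proof.
move=> t0; rewrite power_dilationE// /square_operator powR_mulrn ?ltW//.
by rewrite expr2 invfM mulrA divff ?gt_eqF// mul1r mulrC.
Qed.

(* The values s^-1 f(s) decrease and t `^ a decreases with a. *)
Lemma le_power_dilation a b f t : quasiconcave f -> 0 < t <= 1 -> 0 <= a ->
  a <= b -> power_dilation a f t <= power_dilation b f t.
Proof.
move=> qf t01 a0 ab; have /andP[t0 t1] := t01.
have /andP[ta0 ta1] := powR_itv01 a0 t01.
have /andP[tb0 tb1] := powR_itv01 (le_trans a0 ab) t01.
have tba : t `^ b <= t `^ a by apply: ger_powR.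
have [_ _ h] := qf _ _ tb0 tba ta1.
rewrite !power_dilationE// -!mulrA ler_pM2l// mulrC ler_pdivrMr//.
by rewrite mulrAC -mulrA mulrC ler_pdivlMr// mulrC.
Qed.

Lemma power_dilation_div a f s t : quasiconcave f -> 0 <= a ->
  0 < s -> s <= t -> t <= 1 ->
  s * power_dilation a f t <= t * power_dilation a f s.
Proof.
move=> qf a0 s0 st t1; have t0 := lt_le_trans s0 st.
have t01 : 0 < t <= 1 by rewrite t0.
have s01 : 0 < s <= 1 by rewrite s0 (le_trans st).
have /andP[ta0 ta1] := powR_itv01 a0 t01.
have /andP[sa0 sa1] := powR_itv01 a0 s01.
have sta : s `^ a <= t `^ a by apply: ge0_ler_powR => //; rewrite nnegrE ltW.
have [_ _ h] := qf _ _ sa0 sta ta1.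
rewrite !power_dilationE// !mulrA (mulrC t s) -!mulrA !ler_pM2l ?mulr_gt0//.
by rewrite mulrC ler_pdivrMr// mulrAC -mulrA mulrC ler_pdivlMr// mulrC.
Qed.

Lemma quasiconcave_power_dilation a f : 0 <= a <= 1 -> quasiconcave f ->
  quasiconcave (power_dilation a f).
Proof.
move=> /andP[a0 a1] qf s t s0 st t1; have t0 := lt_le_trans s0 st.
have t01 : 0 < t <= 1 by rewrite t0.
have s01 : 0 < s <= 1 by rewrite s0 (le_trans st).
have /andP[ta0 ta1] := powR_itv01 a0 t01.
have /andP[sa0 sa1] := powR_itv01 a0 s01.
have sta : s `^ a <= t `^ a by apply: ge0_ler_powR => //; rewrite nnegrE ltW.
have [f0 fst _] := qf _ _ sa0 sta ta1; split.
- by rewrite mulr_ge0 ?powR_ge0.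
- apply: ler_pM => //; first exact: powR_ge0.
  by apply: ge0_ler_powR; rewrite ?subr_ge0// nnegrE ltW.
- exact: power_dilation_div.
Qed.

End quasiconcave_functions.

(** * The K-functional and real interpolation *)

Section K_functional_theory.
Context {R : realType} {V : zmodType}.
Implicit Types (N : V -> \bar R) (x y : V) (s t : R).

(** Definiteness is absent because it fails for [L1_norm] and [Linfty_norm], which live on functions
    rather than on a.e. classes. *)
Definition ext_seminorm N : Prop := [/\ forall x, (0 <= N x)%E, N 0 = 0%E,
  forall x, N (- x) = N x & forall x y, (N (x + y)%R <= N x + N y)%E].

Section nonnegative.
Variables (N0 N1 : V -> \bar R).
Hypotheses (N0_ge0 : forall x, (0 <= N0 x)%E) (N1_ge0 : forall x, (0 <= N1 x)%E).
Local Notation K := (K_functional N0 N1).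

Lemma K_functional_ge0 t x : 0 <= t -> (0 <= K t x)%E.
Proof.
move=> t0; apply: le_ereal_inf_tmp => _ [a0 [a1 [_ _ _ ->]]].
by rewrite adde_ge0// mule_ge0.
Qed.

Lemma K_functional_le t x a0 a1 : (N0 a0 < +oo)%E -> (N1 a1 < +oo)%E ->
  x = a0 + a1 -> (K t x <= N0 a0 + t%:E * N1 a1)%E.
Proof. by move=> n0 n1 ->; apply: ereal_inf_lbound; exists a0, a1. Qed.

Lemma K_functional_fin_num t x : 0 <= t -> in_sum N0 N1 x ->
  K t x \is a fin_num.
Proof.
move=> t0 [a0 [a1 [n0 n1 xE]]]; rewrite ge0_fin_numE ?K_functional_ge0//.
apply: le_lt_trans (K_functional_le t n0 n1 xE) _.
by rewrite lte_add_pinfty// lte_mul_pinfty.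
Qed.

Lemma K_functional_notin t x : ~ in_sum N0 N1 x -> K t x = +oo%E.
Proof.
move=> nx; rewrite /K_functional [X in ereal_inf X](_ : _ = set0) ?ereal_inf0//.
apply/seteqP; split => // k [a0 [a1 [n0 n1 xE _]]]; apply: nx.
by exists a0, a1.
Qed.

Lemma K_functional_nd s t x : s <= t -> (K s x <= K t x)%E.
Proof.
move=> st; apply: le_ereal_inf_tmp => _ [a0 [a1 [n0 n1 xE ->]]].
apply: le_trans (K_functional_le s n0 n1 xE) _.
by rewrite leeD2l// lee_wpmul2r// lee_fin.
Qed.

Lemma K_functional_div s t x : 0 < s -> s <= t ->
  ((s / t)%:E * K t x <= K s x)%E.
Proof.
move=> s0 st; have t0 := lt_le_trans s0 st.
apply: le_ereal_inf_tmp => _ [a0 [a1 [n0 n1 xE ->]]].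
have st1 : 0 <= s / t <= 1.
  by rewrite divr_ge0 ?(ltW s0) ?(ltW t0)//= ler_pdivrMr// mul1r.
case/andP: st1 => st0 st1.
apply: le_trans (lee_wpmul2l _ (K_functional_le t n0 n1 xE)) _.
  by rewrite lee_fin.
rewrite ge0_muleDr ?mule_ge0 ?lee_fin ?(ltW t0)// muleA -EFinM divfK ?gt_eqF//.
by rewrite leeD2r// -[leRHS]mul1e lee_wpmul2r// lee_fin.
Qed.

Lemma quasiconcave_K_functional x : in_sum N0 N1 x ->
  quasiconcave (fun t => fine (K t x)).
Proof.
move=> sx s t s0 st t1; have t0 := lt_le_trans s0 st.
have fs := K_functional_fin_num (ltW s0) sx.
have ft := K_functional_fin_num (ltW t0) sx; split.
- by rewrite fine_ge0// K_functional_ge0// ltW.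
- by rewrite fine_le// K_functional_nd.
- have := K_functional_div x s0 st.
  rewrite -(fineK fs) -(fineK ft) -EFinM lee_fin.
  by rewrite mulrAC ler_pdivrMr// (mulrC _ t).
Qed.

Lemma K_functional_approx t x (e : R) : 0 <= t -> in_sum N0 N1 x -> 0 < e ->
  exists a0 a1 : V, [/\ (N0 a0 < +oo)%E, (N1 a1 < +oo)%E, x = a0 + a1 &
    (N0 a0 + t%:E * N1 a1 <= K t x + e%:E)%E].
Proof.
move=> t0 sx e0.
have [_ [a0 [a1 [n0 n1 xE ->]]] h] :=
  lb_ereal_inf_adherent e0 (K_functional_fin_num t0 sx).
by exists a0, a1; split => //; exact: ltW.
Qed.

Lemma K_functional_measurable x :
  measurable_fun (`]0, +oo[ : set R) (fun t => K t x).
Proof.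
have [sx|nx] := pselect (in_sum N0 N1 x); last first.
  rewrite (_ : (fun t => _) = cst +oo%E); first exact: measurable_cst.
  by apply/funext => t; rewrite K_functional_notin.
(* Clamping at 0 gives a finite monotone function on the whole line; K is only known to be finite
   for t >= 0. *)
pose g t := fine (K (Num.max 0 t) x).
have mg : measurable_fun (`]0, +oo[ : set R) (EFin \o g).
  apply/measurable_EFinP; apply: nondecreasing_measurable => // s t st.
  rewrite /g fine_le ?K_functional_fin_num ?le_max ?lexx//.
  by apply: K_functional_nd; rewrite ge_max !le_max lexx st /= orbT.
apply: eq_measurable_fun mg => t; rewrite inE/= in_itv/= andbT => t0.
by rewrite /g (max_idPr (ltW t0)) fineK// K_functional_fin_num// ltW.
Qed.

End nonnegative.

Section ordered.
Variables (N0 N1 : V -> \bar R).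
Hypotheses (sN0 : ext_seminorm N0) (sN1 : ext_seminorm N1).
Hypothesis N01 : forall x, (N0 x <= N1 x)%E.
Local Notation K := (K_functional N0 N1).

Lemma in_sum_ordered x : in_sum N0 N1 x <-> (N0 x < +oo)%E.
Proof.
have [_ _ _ D0] := sN0; have [_ z1 _ _] := sN1; split => [|n0].
- move=> [a0 [a1 [n0 n1 ->]]]; apply: le_lt_trans (D0 _ _) _.
  by rewrite lte_add_pinfty// (le_lt_trans (N01 _)).
- by exists x, 0; rewrite z1 addr0.
Qed.

Lemma K_functional_le0 t x : (K t x <= N0 x)%E.
Proof.
have [_ z1 _ _] := sN1.
have [n0|] := ltP (N0 x) +oo%E; last by rewrite leye_eq => /eqP ->; rewrite leey.
have := @K_functional_le N0 N1 t x x 0 n0.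
by rewrite z1 addr0 mule0 adde0; apply.
Qed.

Lemma K_functional_le1 t x : 0 < t -> (K t x <= t%:E * N1 x)%E.
Proof.
move=> t0; have [_ z0 _ _] := sN0.
have [n1|] := ltP (N1 x) +oo%E; last first.
  by rewrite leye_eq => /eqP ->; rewrite gt0_muley ?leey// lte_fin.
have := @K_functional_le N0 N1 t x 0 x _ n1.
by rewrite z0 add0r add0e; apply.
Qed.

Lemma K_functional_sub t x y : 0 <= t -> (K t (x - y) <= K t x + K t y)%E.
Proof.
move=> t0; have [p0 _ m0 D0] := sN0; have [p1 _ m1 D1] := sN1.
have := K_functional_ge0 p0 p1 x t0; have := K_functional_ge0 p0 p1 y t0.
have [sx|/K_functional_notin->] := pselect (in_sum N0 N1 x); last first.
  by move=> h _; rewrite addye ?leey// gt_eqF// (lt_le_trans _ h).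
have [sy|/K_functional_notin->] := pselect (in_sum N0 N1 y); last first.
  by move=> _ h; rewrite addey ?leey// gt_eqF// (lt_le_trans _ h).
move=> _ _; apply/lee_addgt0Pr => e e0.
have e20 : 0 < e / 2 by rewrite divr_gt0.
have [a0 [a1 [n0 n1 xE lx]]] := K_functional_approx p0 p1 t0 sx e20.
have [b0 [b1 [k0 k1 yE ly]]] := K_functional_approx p0 p1 t0 sy e20.
have xyE : x - y = (a0 - b0) + (a1 - b1).
  by rewrite xE yE opprD addrACA.
have l0 : (N0 (a0 - b0)%R <= N0 a0 + N0 b0)%E by rewrite -(m0 b0).
have l1 : (N1 (a1 - b1)%R <= N1 a1 + N1 b1)%E by rewrite -(m1 b1).
have := K_functional_le t _ _ xyE => /(_ N0 N1).
move=> /(_ (le_lt_trans l0 _) (le_lt_trans l1 _)) => /(_ _ _)/le_trans; apply.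
- by rewrite lte_add_pinfty.
- by rewrite lte_add_pinfty.
rewrite [in leRHS](splitr e) EFinD addeACA; apply: le_trans (leeD lx ly).
rewrite addeACA -ge0_muleDr//; apply: leeD => //.
by rewrite lee_wpmul2l// lee_fin.
Qed.

End ordered.
End K_functional_theory.

(** * Integrals of powers near 0 and near infinity *)

Section power_integrals.
Context {R : realType}.
Local Notation mu := (@lebesgue_measure R).
Implicit Types a b c : R.

Lemma integral_powR a b c : c != 0 -> 0 < a -> a < b ->
  (\int[mu]_(u in `[a, b]) (u `^ (c - 1))%:E = ((b `^ c - a `^ c) / c)%:E)%E.
Proof.
move=> c0 a0 ab.
have dF (u : R) : 0 < u ->
    is_derive u 1 (fun u => c^-1 * u `^ c) (u `^ (c - 1)).
  move=> u0; have := is_derive1_powR c u0 => h.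
  have := is_deriveZ c^-1 h.
  by rewrite /GRing.scale/= mulrA mulVf// mul1r.
have cF (u : R) (d : R) : 0 < u -> {for u, continuous (fun u => u `^ d)}.
  move=> u0; apply: differentiable_continuous; apply/derivable1_diffP.
  by have [] := is_derive1_powR d u0.
rewrite (@continuous_FTC2 _ _ (fun u => c^-1 * u `^ c))//.
- by rewrite -EFinB -mulrBr mulrC.
- apply: continuous_in_subspaceT => u; rewrite inE/= in_itv/= => /andP[au _].
  exact/cF/(lt_le_trans a0).
- split.
  + move=> u; rewrite in_itv/= => /andP[au _].
    by have [] := dF u (lt_trans a0 au).
  + apply: cvg_at_right_filter; apply: cvgM; first exact: cvg_cst.
    exact: cF.
  + apply: cvg_at_left_filter; apply: cvgM; first exact: cvg_cst.
    by apply: cF; exact: lt_trans ab.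
- move=> u; rewrite in_itv/= => /andP[au _].
  rewrite derive1E; have [_] := dF u (lt_trans a0 au); exact.
Qed.

Lemma ge0_integral_bigcup_le (F : (set R)^nat) (f : R -> \bar R) (M : \bar R) :
  {homo F : n m / (n <= m)%N >-> (n <= m)%O} ->
  (forall n, measurable (F n)) ->
  measurable_fun (\bigcup_n F n) f ->
  (forall u, (\bigcup_n F n) u -> 0 <= f u)%E ->
  (forall n, \int[mu]_(u in F n) f u <= M)%E ->
  (\int[mu]_(u in \bigcup_n F n) f u <= M)%E.
Proof.
move=> ndF mF mf f0 FM.
have sF n : F n `<=` \bigcup_n F n by move=> u Fu; exists n.
have cv : (\int[mu]_(u in F n) f u)%E @[n --> \oo] -->
    (\int[mu]_(u in \bigcup_n F n) f u)%E.
  apply: ge0_nondecreasing_set_cvg_integral => // n.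
    exact: measurable_funS (bigcup_measurable (fun n _ => mF n)) (sF n) mf.
  by move=> u /sF; exact: f0.
rewrite -(cvg_lim _ cv)//; apply: lime_le.
  by apply/cvg_ex; eexists; exact: cv.
exact: nearW.
Qed.

Lemma integral_powR_0b_le b c : 0 < c -> 0 < b ->
  (\int[mu]_(u in `]0%R, b]) (u `^ (c - 1))%:E <= (b `^ c / c)%:E)%E.
Proof.
move=> c0 b0.
(* With n + 2 the lower endpoint stays strictly below b even for n = 0, as [integral_powR]
   demands. *)
have -> : `]0, b]%classic = \bigcup_n `[b / n.+2%:R, b]%classic :> set R.
  apply/seteqP; split => u /=; rewrite ?in_itv/=.
  - move=> /andP[u0 ub]; exists (Num.truncn (b / u)) => //=.
    rewrite in_itv/= ub andbT ler_pdivrMr// mulrC -ler_pdivrMr//.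
    rewrite (le_trans (ltW (truncnS_gt _)))// ler_nat//.
  - move=> [n _] /=; rewrite in_itv/= => /andP[bu ->]; rewrite andbT.
    by apply: lt_le_trans bu; rewrite divr_gt0.
apply: ge0_integral_bigcup_le.
- move=> n m nm; apply/subsetPset/subset_itvr; rewrite bnd_simp.
  by rewrite ler_pM2l// lef_pV2 ?posrE// ler_nat !ltnS.
- by [].
- apply/measurable_EFinP; apply: measurable_funTS.
  exact: measurable_powR.
- by move=> u _; rewrite lee_fin powR_ge0.
- move=> n; rewrite integral_powR ?gt_eqF ?divr_gt0//; last first.
    by rewrite ltr_pdivrMr// ltr_pMr// ltr1n.
  by rewrite lee_fin ler_pM2r ?invr_gt0// gerBl powR_ge0.
Qed.

Lemma integral_powR_1y_le c : 0 < c ->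
  (\int[mu]_(u in `[1%R, +oo[) (u `^ (- c - 1))%:E <= (c^-1)%:E)%E.
Proof.
move=> c0.
have -> : `[1, +oo[%classic = \bigcup_n `[1, n.+2%:R]%classic :> set R.
  apply/seteqP; split => u /=; rewrite ?in_itv/= ?andbT.
  - move=> u1; exists (Num.truncn u) => //=; rewrite in_itv/= u1/=.
    by rewrite (le_trans (ltW (truncnS_gt _)))// ler_nat.
  - by move=> [n _] /=; rewrite in_itv/= => /andP[].
apply: ge0_integral_bigcup_le.
- move=> n m nm; apply/subsetPset/subset_itvl; rewrite bnd_simp.
  by rewrite ler_nat !ltnS.
- by [].
- apply/measurable_EFinP; apply: measurable_funTS.
  exact: measurable_powR.
- by move=> u _; rewrite lee_fin powR_ge0.
- move=> n; rewrite integral_powR ?oppr_eq0 ?gt_eqF ?ltr1n//.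
  rewrite lee_fin powR1 invrN mulrN -mulNr opprB.
  by rewrite ler_pdivrMr// mulVf ?gt_eqF// gerBl powR_ge0.
Qed.

End power_integrals.

(** * Bounds for the real interpolation norm *)

Section real_interpolation.
Context {R : realType} {V : zmodType}.
Local Notation mu := (@lebesgue_measure R).
Variables (N0 N1 : V -> \bar R).
Implicit Types (x : V) (s t M theta p : R) (q : \bar R).

Lemma ge0_le_poweR p : 0 <= p ->
  forall a b : \bar R, (0 <= a -> a <= b -> a `^ p <= b `^ p)%E.
Proof.
move=> p0 a b a0 ab; apply: gt0_ler_poweR => //; rewrite in_itv/= leey andbT//.
exact: le_trans ab.
Qed.

Lemma real_interpolation_norm_ge0 theta q x :
  (forall y, 0 <= N0 y)%E -> (forall y, 0 <= N1 y)%E -> (1 <= q)%E ->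
  (0 <= real_interpolation_norm N0 N1 theta q x)%E.
Proof.
move=> p0 p1 q1; have sup0 : (0 <= ereal_sup
    [set (s `^ (- theta))%:E * K_functional N0 N1 s x | s in `]0%R, +oo[])%E.
  apply: le_ereal_sup_tmp; exists ((1 `^ (- theta))%:E * K_functional N0 N1 1 x)%E.
    by exists 1 => //=; rewrite in_itv/= ltr01.
  by rewrite mule_ge0 ?lee_fin ?powR_ge0// K_functional_ge0.
by case: q q1 => [p| |] //= _; exact: poweR_ge0.
Qed.

Lemma real_interpolation_integrand_measurable theta p x :
  (forall y, 0 <= N0 y)%E -> (forall y, 0 <= N1 y)%E ->
  measurable_fun (`]0, +oo[ : set R) (fun s =>
    ((s `^ (- theta))%:E * K_functional N0 N1 s x) `^ p * (s^-1)%:E)%E.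
Proof.
move=> p0 p1; apply: emeasurable_funM.
- apply: (measurableT_comp (measurable_poweR p)); apply: emeasurable_funM.
    apply/measurable_EFinP; apply: measurable_funTS; exact: measurable_powR.
  exact: K_functional_measurable.
- apply/measurable_EFinP; apply: measurable_fun_invr => //.
  by apply: subset_itvr; rewrite bnd_simp.
Qed.

(** This is the embedding of A_(theta,q) into A_(theta,oo). On [s, 2s], K is at least K(s, x) and u
    [^ (- theta) at least (2s)]^ (- theta), while du / u has mass at least 1/2 there. The loss is 2
    [^ theta times 2]^ p^-1, at most 4 whatever theta and q are. *)
Lemma K_functional_le_interpolation theta q x s :
  (forall y, 0 <= N0 y)%E -> (forall y, 0 <= N1 y)%E ->
  0 < theta < 1 -> (1 <= q)%E -> 0 < s ->
  ((s `^ (- theta))%:E * K_functional N0 N1 s x <=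
   4%:E * real_interpolation_norm N0 N1 theta q x)%E.
Proof.
move=> p0 p1 /andP[th0 th1] q1 s0; have K0 := K_functional_ge0 p0 p1 x (ltW s0).
have sK0 : (0 <= (s `^ (- theta))%:E * K_functional N0 N1 s x)%E.
  by rewrite mule_ge0// lee_fin powR_ge0.
have Ksup : ((s `^ (- theta))%:E * K_functional N0 N1 s x <= ereal_sup
    [set (s `^ (- theta))%:E * K_functional N0 N1 s x | s in `]0%R, +oo[])%E.
  by apply: ereal_sup_ubound; exists s => //=; rewrite in_itv/= s0.
have sup4 : ((s `^ (- theta))%:E * K_functional N0 N1 s x <= 4%:E * ereal_sup
    [set (s `^ (- theta))%:E * K_functional N0 N1 s x | s in `]0%R, +oo[])%E.
  apply: (le_trans Ksup); rewrite -[leLHS]mul1e lee_wpmul2r ?lee_fin ?ler1n//.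
  exact: le_trans sK0 Ksup.
case: q q1 => [p| |] //=; rewrite lee_fin => p1'; have p0' := lt_le_trans ltr01 p1'.
set X := (\int[_]_(_ in _) _)%E.
pose c := ((((2 * s) `^ (- theta))%:E * K_functional N0 N1 s x) `^ p)%E.
have c0 : (0 <= c)%E by exact: poweR_ge0.
have s20 : 0 < 2 * s by rewrite mulr_gt0.
have cX : (c * (2^-1)%:E <= X)%E.
  have mg := @real_interpolation_integrand_measurable theta p x p0 p1.
  have sub : (`[s, 2 * s] : set R) `<=` `]0, +oo[.
    by move=> u /=; rewrite !in_itv/= andbT => /andP[+ _]; exact: lt_le_trans.
  have g0 u : [set` `]0%R, +oo[] u ->
      (0 <= (((u `^ (- theta))%:E * K_functional N0 N1 u x) `^ p * (u^-1)%:E))%E.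
    rewrite /= in_itv/= andbT => u0.
    by rewrite mule_ge0 ?poweR_ge0// lee_fin invr_ge0 ltW.
  have hX : (\int[mu]_(u in `[s, (2 * s)%R])
      (((u `^ (- theta))%:E * K_functional N0 N1 u x) `^ p * (u^-1)%:E) <= X)%E.
    exact: ge0_subset_integral.
  apply: le_trans hX.
  have -> : (c * (2^-1)%:E =
      \int[mu]_(u in `[s, (2 * s)%R]) cst (c * ((2 * s)^-1)%:E) u)%E.
    rewrite integral_cst//= lebesgue_measure_itv/= lte_fin.
    rewrite ltr_pMl// ltr1n -EFinB -muleA -EFinM; congr (_ * _%:E)%E.
    by field; rewrite gt_eqF.
  apply: ge0_le_integral => //.
  - by move=> u _; rewrite mule_ge0// lee_fin invr_ge0 ltW.
  - exact: measurable_funS sub mg.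
  - move=> u /=; rewrite in_itv/= => /andP[su us].
    have u0 := lt_le_trans s0 su.
    apply: lee_pmul => //; first by rewrite lee_fin invr_ge0 ltW.
    + apply: ge0_le_poweR; first exact: ltW.
        by rewrite mule_ge0// lee_fin powR_ge0.
      apply: lee_pmul => //; first by rewrite lee_fin powR_ge0.
      * rewrite lee_fin !powRN lef_pV2 ?posrE ?powR_gt0//.
        by rewrite ge0_ler_powR ?nnegrE// ltW.
      * exact: K_functional_nd.
    + by rewrite lee_fin lef_pV2.
have := ge0_le_poweR (p := p^-1) _ _ cX.
rewrite invr_ge0 (ltW p0') => /(_ isT).
rewrite mule_ge0// => /(_ isT).
rewrite poweRM// /c -poweRrM mulfV ?gt_eqF// poweRe1; last first.
  by rewrite mule_ge0// lee_fin powR_ge0.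
move=> /(lee_wpmul2l (x := 4%:E)) => /(_ _)/(le_trans _); apply => //.
rewrite poweR_EFin powRM ?(ltW s0)// muleA muleAC muleA -!EFinM.
have h : 2^-1 <= 2^-1 `^ p^-1 :> R.
  by apply: ger1_powR; rewrite ?invr_gt0 ?invf_le1 ?ler1n ?ltr0n.
have k : 2^-1 <= 2 `^ (- theta) :> R.
  rewrite powRN lef_pV2 ?posrE ?powR_gt0//.
  by apply: ler1_powR; rewrite ?ler1n// ltW.
rewrite lee_wpmul2r// lee_fin.
rewrite [leRHS](_ : _ = (4 * (2^-1 `^ p^-1) * (2 `^ (- theta))) * s `^ (- theta));
  last by ring.
rewrite -[leLHS]mul1r ler_wpM2r ?powR_ge0//; nra.
Qed.

End real_interpolation.

(* The last bound on K is the one available for ordered pairs, where K(s, x) is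
   constant for s >= 1. *)
Lemma real_interpolation_norm_le (R : realType) (theta theta' : R) (q : \bar R) :
  0 < theta -> theta < theta' -> (1 <= q)%E ->
  exists2 C : R, 0 < C &
    forall (V : zmodType) (N0 N1 : V -> \bar R) (x : V) (M : R),
    (forall y, 0 <= N0 y)%E -> (forall y, 0 <= N1 y)%E -> 0 <= M ->
    (forall s, 0 < s <= 1 ->
       (K_functional N0 N1 s x <= (M * s `^ theta')%:E)%E) ->
    (forall s, 1 <= s -> (K_functional N0 N1 s x <= M%:E)%E) ->
    (real_interpolation_norm N0 N1 theta q x <= (C * M)%:E)%E.
Proof.
move=> th0 thth'.
have small (V : zmodType) (N0 N1 : V -> \bar R) (x : V) (M : R) s :
    0 < s -> (K_functional N0 N1 s x <= (M * s `^ theta')%:E)%E ->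
    ((s `^ (- theta))%:E * K_functional N0 N1 s x <=
     (M * s `^ (theta' - theta))%:E)%E.
  move=> s0 h; apply: le_trans (lee_wpmul2l _ h) _.
    by rewrite lee_fin powR_ge0.
  rewrite -EFinM lee_fin mulrCA -powRD ?(gt_eqF s0) ?implybT//.
  by rewrite (addrC (- theta)).
have large (V : zmodType) (N0 N1 : V -> \bar R) (x : V) (M : R) s :
    (K_functional N0 N1 s x <= M%:E)%E ->
    ((s `^ (- theta))%:E * K_functional N0 N1 s x <= (M * s `^ (- theta))%:E)%E.
  move=> h; apply: le_trans (lee_wpmul2l _ h) _; first by rewrite lee_fin powR_ge0.
  by rewrite -EFinM lee_fin mulrC.
case: q => [p| |] // q1; last first.
  exists 1 => // V N0 N1 x M p0 p1 M0 h h'; rewrite mul1r.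
  apply: ge_ereal_sup => _ [s /= + <-]; rewrite in_itv/= andbT => s0.
  have [s1|s1] := leP s 1.
    apply: le_trans (small _ _ _ _ _ _ s0 (h _ _)) _; first by rewrite s0.
    rewrite lee_fin ler_piMr//; have /andP[//] : 0 < s `^ (theta' - theta) <= 1.
    by apply: powR_itv01; rewrite ?s0// subr_ge0 ltW.
  apply: le_trans (large _ _ _ _ _ _ (h' _ (ltW s1))) _.
  rewrite lee_fin ler_piMr// powRN invf_le1 ?powR_gt0// ?(lt_trans ltr01 s1)//.
  by rewrite -[leLHS](powRr0 s) ler_powR// ltW.
have p1 : 1 <= p by [].
have p0 := lt_le_trans ltr01 p1.
(* These are the decay exponents of the integrand at 0 and at infinity; c1 > 0 is where theta <
   theta' enters. *)
pose c1 := (theta' - theta) * p; pose c2 := theta * p.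
have c10 : 0 < c1 by rewrite mulr_gt0// subr_gt0.
have c20 : 0 < c2 by rewrite mulr_gt0.
exists ((c1^-1 + c2^-1) `^ p^-1).
  by rewrite powR_gt0// addr_gt0 ?invr_gt0.
move=> V N0 N1 x M N0_ge0 N1_ge0 M0 h h'.
set mu := @lebesgue_measure R.
pose g s :=
  (((s `^ (- theta))%:E * K_functional N0 N1 s x) `^ p * (s^-1)%:E)%E.
rewrite /= -/mu -/g.
have mg : measurable_fun (`]0, +oo[ : set R) g.
  exact: real_interpolation_integrand_measurable.
have g0 s : 0 < s -> (0 <= g s)%E.
  by move=> s0; rewrite mule_ge0 ?poweR_ge0// lee_fin invr_ge0 ltW.
have key s a : 0 < s -> ((s `^ (- theta))%:E * K_functional N0 N1 s x <=
     (M * s `^ a)%:E)%E -> (g s <= (M `^ p)%:E * (s `^ (a * p - 1))%:E)%E.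
  move=> s0 le.
  have sK0 : (0 <= (s `^ (- theta))%:E * K_functional N0 N1 s x)%E.
    by rewrite mule_ge0 ?lee_fin ?powR_ge0// K_functional_ge0// ltW.
  apply: le_trans (lee_wpmul2r _ (ge0_le_poweR (ltW p0) sK0 le)) _.
    by rewrite lee_fin invr_ge0 ltW.
  rewrite poweR_EFin -!EFinM lee_fin powRM ?powR_ge0// -powRrM -mulrA.
  by rewrite powRB ?(gt_eqF s0) ?implybT// powRr1 ?(ltW s0).
have I0 : (\int[mu]_(s in `]0%R, 1%R]) g s <= (M `^ p * c1^-1)%:E)%E.
  apply: (@le_trans _ _ (\int[mu]_(s in `]0%R, 1%R])
      ((M `^ p)%:E * (s `^ (c1 - 1))%:E))%E).
    apply: ge0_le_integral => //.
    - by move=> s /=; rewrite in_itv/= => /andP[s0 _]; exact: g0.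
    - by apply: measurable_funS mg => //; apply: subset_itvl; rewrite bnd_simp.
    - apply/measurable_EFinP; apply: measurable_funM => //.
      apply: measurable_funTS; exact: measurable_powR.
    - move=> s /=; rewrite in_itv/= => /andP[s0 s1].
      by apply: key => //; apply: small => //; apply: h; rewrite s0.
  rewrite ge0_integralZl//; last 3 first.
  - apply/measurable_EFinP; apply: measurable_funTS; exact: measurable_powR.
  - by move=> s _; rewrite lee_fin powR_ge0.
  - by rewrite lee_fin powR_ge0.
  rewrite EFinM lee_wpmul2l// ?lee_fin ?powR_ge0//.
  by have := integral_powR_0b_le c10 (@ltr01 R); rewrite powR1 div1r.
have I1 : (\int[mu]_(s in `]1%R, +oo[) g s <= (M `^ p * c2^-1)%:E)%E.
  apply: (@le_trans _ _ (\int[mu]_(s in `]1%R, +oo[)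
      ((M `^ p)%:E * (s `^ (- c2 - 1))%:E))%E).
    apply: ge0_le_integral => //.
    - move=> s /=; rewrite in_itv/= andbT => s1; apply: g0.
      exact: lt_trans s1.
    - by apply: measurable_funS mg => //; apply: subset_itvr; rewrite bnd_simp.
    - apply/measurable_EFinP; apply: measurable_funM => //.
      apply: measurable_funTS; exact: measurable_powR.
    - move=> s /=; rewrite in_itv/= andbT => s1.
      rewrite -mulNr; apply: key; first exact: lt_trans s1.
      by apply: large => //; apply: h'; exact: ltW.
  rewrite ge0_integralZl//; last 3 first.
  - apply/measurable_EFinP; apply: measurable_funTS; exact: measurable_powR.
  - by move=> s _; rewrite lee_fin powR_ge0.
  - by rewrite lee_fin powR_ge0.
  rewrite EFinM lee_wpmul2l// ?lee_fin ?powR_ge0//.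
  apply: le_trans (integral_powR_1y_le c20).
  apply: ge0_subset_integral => //.
  - apply/measurable_EFinP; apply: measurable_funTS; exact: measurable_powR.
  - by move=> s _; rewrite lee_fin powR_ge0.
  - by apply: subset_itvr; rewrite bnd_simp.
have U : `]0, +oo[%classic = `]0, 1]%classic `|` `]1, +oo[%classic :> set R.
  by rewrite -itv_bndbnd_setU// bnd_simp.
have I : (\int[mu]_(s in `]0%R, +oo[) g s <=
    (M `^ p * (c1^-1 + c2^-1))%:E)%E.
  rewrite U ge0_integral_setU//=.
  - by rewrite mulrDr EFinD leeD.
  - by rewrite -U.
  - move=> s /= []; rewrite in_itv/=; first by move=> /andP[s0 _]; exact: g0.
    by rewrite andbT => s1; apply: g0; exact: lt_trans s1.
  - rewrite disj_set2E; apply/eqP/seteqP; split => // s /=.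
    by rewrite !in_itv/= => -[/andP[_ s1]]; rewrite andbT ltNge s1.
have Ip : (0 <= \int[mu]_(s in `]0%R, +oo[) g s)%E.
  by apply: integral_ge0 => s /=; rewrite in_itv/= andbT; exact: g0.
have pV0 : 0 <= p^-1 by rewrite invr_ge0 ltW.
apply: le_trans (ge0_le_poweR pV0 Ip I) _.
rewrite poweR_EFin lee_fin powRM ?powR_ge0//; last first.
  by rewrite addr_ge0// invr_ge0 ltW.
by rewrite -powRrM mulfV ?gt_eqF// powRr1// mulrC.
Qed.

(** * Comparison of the K-functionals of a pair and of its interpolated pair *)

Section K_functional_interpolation.
Context {R : realType} {V : zmodType}.
Variables (N0 N1 : V -> \bar R).
Hypotheses (sN0 : ext_seminorm N0) (sN1 : ext_seminorm N1).
Hypothesis N01 : forall x, (N0 x <= N1 x)%E.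
Implicit Types (x : V) (s t theta : R) (q : \bar R).

Let N0_ge0 x : (0 <= N0 x)%E. Proof. by have [] := sN0. Qed.
Let N1_ge0 x : (0 <= N1 x)%E. Proof. by have [] := sN1. Qed.

(** A_(theta,q) lies in A_0: K(1, a) = +oo off the sum, so [K_functional_le_interpolation] at s = 1
    makes the interpolation norm infinite there. *)
Lemma in_sum_interpolation theta q x : 0 < theta < 1 -> (1 <= q)%E ->
  in_sum (real_interpolation_norm N0 N1 theta q) N1 x -> in_sum N0 N1 x.
Proof.
move=> th q1 [a [b [Xa n1 ->]]]; apply/in_sum_ordered => //.
have [_ _ _ D0] := sN0; apply: le_lt_trans (D0 _ _) _.
have Nb := le_lt_trans (N01 b) n1; rewrite lte_add_pinfty//.
apply/(in_sum_ordered sN0 sN1 N01); apply: contrapT => /K_functional_notin.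
move=> /(_ 1) K1; have := K_functional_le_interpolation a N0_ge0 N1_ge0 th q1 ltr01.
rewrite K1 powR1 mul1e leye_eq => /eqP X4.
have : (4%:E * real_interpolation_norm N0 N1 theta q a < +oo)%E.
  by rewrite lte_mul_pinfty ?lee_fin.
by rewrite X4 ltxx.
Qed.

(** For x = a0 + a1 and u = t [^ a, K(u, a0) is at most 4 u]^ theta times the interpolation norm of
    a0, and K(u, a1) at most u times the norm of a1. Multiplication by t [^ (1 - a) turns u]^ theta
    into 1 and u into t; the first of these is what fixes a = 1 / (1 - theta). *)
Lemma power_dilation_le_K_functional theta q x t : 0 < theta < 1 -> (1 <= q)%E ->
  in_sum (real_interpolation_norm N0 N1 theta q) N1 x -> 0 < t ->
  power_dilation (1 - theta)^-1 (fun s => fine (K_functional N0 N1 s x)) t <=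
  4 * fine (K_functional (real_interpolation_norm N0 N1 theta q) N1 t x).
Proof.
move=> th q1 sx t0; have sx' := in_sum_interpolation th q1 sx.
have /andP[th0 th1] := th; have th1' : 1 - theta != 0 by rewrite subr_eq0 gt_eqF.
set a := (1 - theta)^-1; set X := real_interpolation_norm N0 N1 theta q.
have X0 y : (0 <= X y)%E by exact: real_interpolation_norm_ge0.
have u0 : 0 < t `^ a by exact: powR_gt0.
rewrite /power_dilation -lee_fin !EFinM !fineK; last 2 first.
- exact: K_functional_fin_num (ltW t0) sx.
- exact: K_functional_fin_num (ltW u0) sx'.
rewrite -lee_pdivrMl//; apply: le_ereal_inf_tmp => _ [a0 [a1 [n0 n1 xE ->]]].
rewrite lee_pdivrMl//.
have E1 : (t `^ (1 - a) * t `^ a = t).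
  by rewrite -powRD ?(gt_eqF t0) ?implybT// subrK powRr1// ltW.
have E2 : (t `^ (1 - a) * (t `^ a) `^ theta = 1).
  rewrite -powRrM -powRD ?(gt_eqF t0) ?implybT//.
  rewrite (_ : 1 - a + a * theta = 0) ?powRr0//.
  by rewrite /a; field.
have [_ _ m1 _] := sN1.
have : (K_functional N0 N1 (t `^ a) x <=
    (t `^ a `^ theta)%:E * (4%:E * X a0) + (t `^ a)%:E * N1 a1)%E.
  rewrite (_ : x = a0 - (- a1)); last by rewrite opprK.
  apply: le_trans (K_functional_sub sN0 sN1 _ _ (ltW u0)) _; apply: leeD.
    apply: (@le_trans _ _ ((t `^ a `^ theta)%:E *
        ((t `^ a `^ (- theta))%:E * K_functional N0 N1 (t `^ a) a0)))%E; last first.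
      by rewrite lee_wpmul2l ?lee_fin ?powR_ge0// K_functional_le_interpolation.
    by rewrite muleA -EFinM powRN mulfV ?mul1e ?lexx// gt_eqF// powR_gt0.
  by rewrite -(m1 a1); exact: K_functional_le1.
move=> h; apply: le_trans (lee_wpmul2l _ h) _; first by rewrite lee_fin powR_ge0.
rewrite ge0_muleDr ?mule_ge0 ?lee_fin ?powR_ge0// !muleA -!EFinM E1.
rewrite E2 mul1r ge0_muleDr ?mule_ge0 ?lee_fin ?(ltW t0)//.
apply: leeD => //; rewrite -[leLHS]mul1e.
by rewrite lee_wpmul2r ?mule_ge0 ?lee_fin ?ler1n ?(ltW t0).
Qed.

End K_functional_interpolation.

(* One half of Holmstedt's formula for the couple (A_{theta,q}, A_1), with the
   integral over (0, t^a) replaced by a supremum at the cost of increasing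
   theta. *)
Lemma K_functional_interpolation_le (R : realType) (theta theta' : R) (q : \bar R) :
  0 < theta -> theta < theta' -> theta' < 1 -> (1 <= q)%E ->
  exists2 C : R, 0 < C & forall (V : zmodType) (N0 N1 : V -> \bar R) (x : V)
      (eta : R -> R),
    ext_seminorm N0 -> ext_seminorm N1 -> (forall y, (N0 y <= N1 y)%E) ->
    in_sum N0 N1 x -> quasiconcave eta ->
    (forall s, 0 < s <= 1 -> power_dilation (1 - theta')^-1
       (fun s => fine (K_functional N0 N1 s x)) s <= eta s) ->
    in_sum (real_interpolation_norm N0 N1 theta q) N1 x /\
    forall t, 0 < t <= 1 ->
      fine (K_functional (real_interpolation_norm N0 N1 theta q) N1 t x)
      <= C * eta t.
Proof.
move=> th0 thth' th1 q1.
have [C C0 HC] := real_interpolation_norm_le th0 thth' q1.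
(* In the decomposition below, a0 costs C * 2 * eta t and a1 costs eta t, up to errors that add up
   to C + 1 times the tolerance. *)
exists (C * 2 + 1); first by rewrite addr_gt0 ?mulr_gt0.
move=> V N0 N1 x eta sN0 sN1 N01 sx qeta etaP.
have [N0_ge0 _ _ _] := sN0; have [N1_ge0 _ m1 _] := sN1.
set X := real_interpolation_norm N0 N1 theta q.
have X0 y : (0 <= X y)%E by exact: real_interpolation_norm_ge0.
pose K s := K_functional N0 N1 s x; pose phi s := fine (K s).
have phiK s : 0 < s -> K s = (phi s)%:E.
  by move=> s0; rewrite fineK// K_functional_fin_num// ltW.
have qphi : quasiconcave phi by exact: quasiconcave_K_functional.
pose b := 1 - theta'; have b0 : 0 < b by rewrite subr_gt0.
have th0' : 0 < theta' by exact: lt_trans thth'.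
have b1 : b < 1 by rewrite gtrBl.
have bb : b^-1 * b = 1 by rewrite mulVf// gt_eqF.
(* The hypothesis at s [^ b is undilated, since (s]^ b) [^ b^-1 = s; its prefactor becomes s]^ (-
   theta'). *)
have phi_le s : 0 < s <= 1 -> phi s <= s `^ theta' * eta (s `^ b).
  move=> s01; have /andP[s0 s1] := s01.
  have := etaP (s `^ b) (powR_itv01 (ltW b0) s01).
  rewrite /power_dilation -/b -!powRrM (mulrC b b^-1) bb powRr1 ?(ltW s0)//.
  rewrite (_ : b * (1 - b^-1) = - theta'); last first.
    by rewrite mulrBr mulr1 mulrC bb /b; ring.
  by rewrite powRN -/(phi s) mulrC ler_pdivrMr ?powR_gt0// mulrC.
(* x is split almost optimally at u = t [^ b^-1, the scale of the original pair that corresponds to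
   t. For s <= 1, K(s, a0) is at most s]^ theta' (2 eta t + e): use N0 a0 when s > u, and K(s, x) +
   s N1 a1 when s <= u. This bounds the interpolation norm of a0. *)
have split_x t e : 0 < t <= 1 -> 0 < e -> exists a0 a1 : V,
    [/\ (X a0 <= (C * (2 * eta t + e))%:E)%E, (N1 a1 < +oo)%E, x = a0 + a1 &
      (t%:E * N1 a1 <= (eta t + e)%:E)%E].
  move=> t01 e0; have /andP[t0 t1] := t01; pose u := t `^ b^-1.
  have u01 : 0 < u <= 1 by apply: powR_itv01; rewrite ?invr_ge0 ?(ltW b0).
  have /andP[u0 u1] := u01.
  have ub : u `^ b = t by rewrite /u -powRrM bb powRr1 ?(ltW t0).
  have uth0 : 0 < u `^ theta' by exact: powR_gt0.
  have uth : u `^ theta' * t = u.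
    rewrite -ub -powRD ?(gt_eqF u0) ?implybT// /b addrC subrK powRr1//.
    exact: ltW.
  have et0 : 0 <= eta t by exact: quasiconcave_ge0.
  have phiu : phi u <= u `^ theta' * eta t by rewrite -[in eta t]ub; exact: phi_le.
  have [a0 [a1 [n0 n1 xE le]]] :=
    K_functional_approx N0_ge0 N1_ge0 (ltW u0) sx (mulr_gt0 uth0 e0).
  have f0 : N0 a0 \is a fin_num by rewrite ge0_fin_numE.
  have f1 : N1 a1 \is a fin_num by rewrite ge0_fin_numE.
  have l0 := fine_ge0 (N0_ge0 a0); have l1 := fine_ge0 (N1_ge0 a1).
  move: le; rewrite -/(K u) phiK// -(fineK f0) -(fineK f1) -EFinM -!EFinD lee_fin.
  set r0 := fine (N0 a0) in l0 *; set r1 := fine (N1 a1) in l1 * => le.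
  have h0 : r0 <= u `^ theta' * (eta t + e).
    by rewrite mulrDr; have := mulr_ge0 (ltW u0) l1; lra.
  have h1 : u * r1 <= u `^ theta' * (eta t + e) by rewrite mulrDr; lra.
  have M0 : 0 <= 2 * eta t + e by rewrite addr_ge0 ?mulr_ge0// ltW.
  have uth1 : u `^ theta' <= 1.
    by have /andP[] := powR_itv01 (ltW th0') u01.
  have r0K s : (K_functional N0 N1 s a0 <= r0%:E)%E.
    by rewrite /r0 fineK//; exact: K_functional_le0.
  exists a0, a1; split => //.
  - apply: HC => // s; last first.
      move=> s1; apply: le_trans (r0K s) _; rewrite lee_fin.
      apply: le_trans h0 _; apply: (@le_trans _ _ (1 * (eta t + e))).
        by rewrite ler_wpM2r// addr_ge0// ltW.
      by lra.
    move=> /andP[s0 s1]; have [su|us] := leP s u; last first.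
      apply: le_trans (r0K s) _; rewrite lee_fin; apply: le_trans h0 _.
      have us' : u `^ theta' <= s `^ theta'.
        by apply: ge0_ler_powR; rewrite ?nnegrE ltW.
      rewrite mulrC; apply: ler_pM; rewrite ?powR_ge0//; last by lra.
      by rewrite addr_ge0// ltW.
    have xE' : a0 = x - a1 by rewrite xE addrK.
    rewrite xE'; apply: le_trans (K_functional_sub sN0 sN1 _ _ (ltW s0)) _.
    have k1 : (K_functional N0 N1 s a1 <= s%:E * N1 a1)%E.
      exact: K_functional_le1.
    apply: le_trans (leeD (lexx _) k1) _.
    rewrite -/(K s) phiK// -(fineK f1) -EFinM -EFinD lee_fin -/r1.
    have [_ _ suphi] := qphi s u s0 su u1.
    have sb : s `^ b <= t.
      by rewrite -ub; apply: ge0_ler_powR => //; rewrite ?nnegrE ltW.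
    have sb0 : 0 < s `^ b by exact: powR_gt0.
    have phis : phi s <= s `^ theta' * eta t.
      have s01 : 0 < s <= 1 by rewrite s0.
      apply: le_trans (phi_le _ s01) _; rewrite ler_wpM2l ?powR_ge0//.
      by have [] := qeta _ _ sb0 sb t1.
    have sth : s `^ theta' * s `^ b = s.
      by rewrite -powRD ?(gt_eqF s0) ?implybT// /b addrC subrK powRr1// ltW.
    (* The bound u r1 <= phi u + u [^ theta' e is rescaled from u down to s: both phi u / u and u]^
       theta' / u grow when u is replaced by the smaller s. *)
    have sr1 : s * r1 <= phi s + s `^ theta' * e.
      rewrite -(ler_pM2l u0) mulrCA.
      apply: (@le_trans _ _ (s * (phi u + u `^ theta' * e))).
        by rewrite ler_pM2l//; lra.
      rewrite mulrDr [leRHS]mulrDr lerD//.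
      rewrite -[X in X * _ <= _]sth -[X in _ <= X * _]uth.
      rewrite [leLHS](_ : _ = (s `^ theta' * u `^ theta' * e) * s `^ b);
        last by ring.
      rewrite [leRHS](_ : _ = (s `^ theta' * u `^ theta' * e) * t);
        last by ring.
      by rewrite ler_wpM2l// !mulr_ge0// ?powR_ge0// ltW.
    by rewrite [leRHS]mulrC mulrDr; lra.
  - rewrite -(fineK f1) -EFinM lee_fin -/r1 -(ler_pM2l uth0) mulrA uth.
    exact: h1.
have sX : in_sum X N1 x.
  have [|a0 [a1 [Xa0 n1 xE _]]] := @split_x 1 1 _ ltr01.
    by rewrite ltr01 lexx.
  by exists a0, a1; split => //; exact: le_lt_trans Xa0 (ltry _).
split => // t t01; have /andP[t0 t1] := t01.
apply/ler_addgt0Pr => e e0; have C10 : 0 < C + 1 by rewrite addr_gt0.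
have [a0 [a1 [Xa0 n1 xE tn1]]] := split_x t (e / (C + 1)) t01 (divr_gt0 e0 C10).
rewrite -lee_fin fineK; last exact: K_functional_fin_num (ltW t0) sX.
have Xfin := le_lt_trans Xa0 (ltry _).
apply: le_trans (K_functional_le t Xfin n1 xE) _.
apply: le_trans (leeD Xa0 tn1) _; rewrite -EFinD lee_fin.
rewrite le_eqVlt; apply/orP; left; apply/eqP.
by field; rewrite gt_eqF.
Qed.

(** * Quasi-concave majorants in the lattice *)

Section null_sets.
Context {R : realType}.
Local Notation mu := (@lebesgue_measure R).

(** The point 0 is discarded as a null set, so that arguments a.e. on [0, 1] may divide by t. *)
Lemma ae_leb01P (P : R -> Prop) : (\forall t \ae leb01 R, P t) <->
  mu.-negligible [set t | 0 < t <= 1 /\ ~ P t].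
Proof.
split=> [[A [mA A0 PA]]|[A [mA A0 PA]]].
- exists (A `&` `[0, 1]%classic); split => //; first exact: measurableI.
  move=> t /= [/andP[t0 t1] nPt]; split; first exact: PA.
  by rewrite in_itv/= (ltW t0).
- exists (A `|` ([set 0] `|` ~` `[0, 1]%classic)); split.
  + apply: measurableU => //; apply: measurableU => //; exact: measurableC.
  + rewrite /leb01/= /mrestr; apply/eqP; rewrite -measure_le0.
    apply: (@le_trans _ _ (mu (A `|` [set 0]))).
      apply: le_measure; rewrite ?inE.
      * apply: measurableI => //; apply: measurableU => //.
        by apply: measurableU => //; exact: measurableC.
      * exact: measurableU.
      * by move=> t [[At|[->|nt]] ti]; [left|right|].
    apply: (@le_trans _ _ (mu A + mu [set 0%R])%E).
      exact: measureU2.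
    by rewrite A0 lebesgue_measure_set1 adde0.
  + move=> t /= nPt; have [t01|] := boolP (0 < t <= 1).
      by left; apply: PA.
    rewrite negb_and -leNgt -ltNge => /orP[]; last first.
      by move=> t1; right; right => /=; rewrite in_itv/= (leNgt t) t1 andbF.
    rewrite le_eqVlt => /predU1P[->|t0]; first by right; left.
    by right; right => /=; rewrite in_itv/= leNgt t0.
Qed.

Lemma ae_leb01 (P : R -> Prop) : (forall t, 0 < t <= 1 -> P t) ->
  \forall t \ae leb01 R, P t.
Proof.
move=> h; apply/ae_leb01P; apply: (@negligibleS _ _ _ _ set0).
  by move=> t [t01]; case; exact: h.
exact: negligible_set0.
Qed.

Lemma ae_leb01S (P Q : R -> Prop) : (forall t, 0 < t <= 1 -> P t -> Q t) ->
  (\forall t \ae leb01 R, P t) -> \forall t \ae leb01 R, Q t.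
Proof.
move=> PQ /ae_leb01P nP; apply/ae_leb01P; apply: negligibleS nP.
by move=> t [t01 nQ]; split => // Pt; apply: nQ; exact: PQ.
Qed.

Lemma ae_leb01I (P Q : R -> Prop) : (\forall t \ae leb01 R, P t) ->
  (\forall t \ae leb01 R, Q t) -> \forall t \ae leb01 R, P t /\ Q t.
Proof.
move=> /ae_leb01P nP /ae_leb01P nQ; apply/ae_leb01P.
apply: negligibleS (negligibleU nP nQ) => t [t01 nPQ].
by have [Pt|] := pselect (P t); [right; split => // Qt; apply: nPQ|left].
Qed.

(** A cover of N by open intervals pulls back to a cover: two points of B with images in an interval
    of length l are at distance at most L l, so that this part of B fits in an interval of length 2
    L l. Outer measure is used, as neither B nor h is assumed measurable. *)
Lemma negligible_preimage (B N : set R) (h : R -> R) (L : R) : 0 <= L ->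
  (forall s t, B s -> B t -> `|s - t| <= L * `|h s - h t|) ->
  mu.-negligible N -> mu.-negligible (B `&` h @^-1` N).
Proof.
move=> L0 hL /negligible_outer_measure N0; apply/negligible_outer_measure.
apply/eqP; rewrite eq_le outer_measure_ge0 andbT.
apply/lee_addgt0Pr => e e0; rewrite add0e.
(* The added 1 keeps the divisor positive when L = 0. *)
have L1 : 0 < 2 * L + 1 by rewrite ltr_wpDl ?mulr_ge0.
have : (ereal_inf [set (\sum_(k <oo) wlength idfun (F k))%E
    | F in open_itv_cover N] < (e / (2 * L + 1))%:E)%E.
  by rewrite -outer_measure_open_itv_cover N0 lte_fin divr_gt0.
move=> /ereal_inf_lt[_ [F [Fi NF] <-] le].
have w0 k : (0 <= wlength idfun (F k))%E by exact: (wlength_ge0 idfun).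
pose G k := B `&` h @^-1` F k.
have sub : B `&` h @^-1` N `<=` \bigcup_k G k.
  by move=> t [Bt /NF[k _ Fk]]; exists k.
apply: (@le_trans _ _ (((wlength idfun)^* (\bigcup_k G k))%mu)).
  exact: le_outer_measure.
apply: (@le_trans _ _ (\sum_(k <oo) ((wlength idfun)^* (G k))%mu)%E).
  exact: outer_measure_sigma_subadditive.
apply: (@le_trans _ _ (\sum_(k <oo) ((2 * L)%:E * wlength idfun (F k)))%E).
  apply: lee_nneseries => k _; first by move=> _; exact: outer_measure_ge0.
  have [[a b] Fab] := Fi k.
  have [[t [Bt Ft]]|G0] := pselect (exists t, G k t); last first.
    rewrite (_ : G k = set0) ?outer_measure0 ?mule_ge0 ?lee_fin ?mulr_ge0//.
    by apply/seteqP; split => // t Gt; apply: G0; exists t.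
  have ab : a < b.
    by move: Ft; rewrite /= Fab/= in_itv/= => /andP[]; exact: lt_trans.
  pose I : set R := `[t - L * (b - a), t + L * (b - a)]%classic.
  have sG : G k `<=` I.
    move=> s [Bs Fs]; rewrite /I/=; rewrite in_itv/= -ler_distlC.
    apply: le_trans (hL _ _ Bt Bs) _; rewrite ler_wpM2l//.
    move: Ft Fs; rewrite /= Fab/= !in_itv/= => /andP[t1 t2] /andP[s1 s2].
    by rewrite ler_norml; lra.
  apply: (@le_trans _ _ ((wlength idfun)^* I)%mu); first exact: le_outer_measure.
  have -> : ((wlength idfun)^* I)%mu = mu I by [].
  rewrite /I lebesgue_measure_itv/= Fab wlength_itv/= !lte_fin ab.
  case: ifP => _; last first.
    by rewrite -EFinD -EFinM lee_fin; rewrite !mulr_ge0 ?subr_ge0 ?(ltW ab).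
  by rewrite -!EFinD -EFinM lee_fin; lra.
rewrite nneseriesZl; last by move=> k _; exact: w0.
apply: le_trans (lee_wpmul2l _ (ltW le)) _; first by rewrite lee_fin mulr_ge0.
rewrite -EFinM lee_fin mulrCA ler_piMr ?(ltW e0)// ler_pdivrMr// mul1r.
by rewrite lerDl.
Qed.

(** This makes [square_operator] compatible with a.e. inequalities. The inverse of squaring is not
    Lipschitz near 0, hence the exhaustion of (0, 1] by [1 / (n + 1), 1], where s + t >= 1 / (n + 1)
    gives the constant n + 1. *)
Lemma ae_leb01_sqr (P : R -> Prop) : (\forall t \ae leb01 R, P t) ->
  \forall t \ae leb01 R, P (t ^+ 2).
Proof.
move=> /ae_leb01P nP; apply/ae_leb01P.
pose h (t : R) := t ^+ 2; pose B n := [set t : R | n.+1%:R^-1 <= t <= 1].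
have nB n : mu.-negligible (B n `&` h @^-1` [set t | 0 < t <= 1 /\ ~ P t]).
  apply: (@negligible_preimage _ _ _ n.+1%:R) => //.
  move=> s t /andP[s0 s1] /andP[t0 t1]; rewrite /h subr_sqr normrM mulrCA.
  have n0 : 0 < n.+1%:R^-1 :> R by rewrite invr_gt0.
  rewrite ler_peMr// -ler_pdivrMl// mulr1 ger0_norm.
    by rewrite (le_trans s0)// lerDl (le_trans _ t0)// ltW.
  by rewrite addr_ge0// (le_trans (ltW n0)).
apply: negligibleS (negligible_bigcup nB).
move=> t [/andP[t0 t1] nPt]; exists (Num.truncn t^-1) => //.
have t2 : 0 < t ^+ 2 <= 1 by rewrite exprn_gt0// exprn_ile1// ltW.
split; last by split.
rewrite /B/= t1 andbT -[leRHS]invrK lef_pV2 ?posrE ?invr_gt0//.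
exact/ltW/truncnS_gt.
Qed.

End null_sets.

(** * The norm of L^oo and essential suprema *)

Section Linfty.
Context {R : realType}.
Local Notation mu := (@lebesgue_measure R).
Implicit Types (f g : R -> R) (c M : R).

Lemma leb01_setT : (leb01 R setT = 1)%E.
Proof.
by rewrite /leb01/= /mrestr setTI lebesgue_measure_itv/= lte_fin ltr01 oppr0 adde0.
Qed.

Lemma Lp01_norm_notin f p : ~ measurable01 f -> Lp01_norm p f = +oo%E.
Proof. by move=> mf; rewrite /Lp01_norm; case: asboolP. Qed.

Lemma Linfty_normE f : measurable01 f ->
  Linfty_norm f = ess_sup (leb01 R) (abse \o (EFin \o f)).
Proof.
move=> mf; rewrite /Linfty_norm /Lp01_norm; case: asboolP => // _.
by rewrite unlock leb01_setT lte01.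
Qed.

Lemma Linfty_norm_ge0 f : (0 <= Linfty_norm f)%E.
Proof.
rewrite /Linfty_norm /Lp01_norm; case: asboolP => // _; exact: Lnorm_ge0.
Qed.

Lemma Linfty_norm_leP f M : (Linfty_norm f <= M%:E)%E <->
  measurable01 f /\ \forall t \ae leb01 R, `|f t| <= M.
Proof.
have [mf|mf] := pselect (measurable01 f); last first.
  rewrite /Linfty_norm Lp01_norm_notin// leye_eq; split => //; by case.
rewrite Linfty_normE//; split => [/ess_supP h|[_ h]].
  by split => //; apply: ae_leb01S h => t _; rewrite /= lee_fin.
by apply/ess_supP; apply: ae_leb01S h => t _; rewrite /= lee_fin.
Qed.

Lemma Linfty_norm_finE f : (Linfty_norm f < +oo)%E ->
  Linfty_norm f = (fine (Linfty_norm f))%:E.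
Proof. by move=> foo; rewrite fineK// ge0_fin_numE// Linfty_norm_ge0. Qed.

(** m is the essential supremum. If m > 0, the set where f >= m / 2 is not null, as m / 2 would
    otherwise be an essential bound; if m = 0, all of (0, 1] serves. *)
Lemma ess_sup_half f M : measurable01 f -> (forall t, 0 < t <= 1 -> 0 <= f t) ->
  (\forall t \ae leb01 R, f t <= M) ->
  exists (m : R) (E : set R), [/\ 0 <= m, \forall t \ae leb01 R, f t <= m,
    measurable E /\ E `<=` `]0, 1], (0 < mu E)%E &
    forall t, E t -> m / 2 <= f t].
Proof.
move=> mf f0 fM; pose m := ess_sup (leb01 R) (EFin \o f).
have m0 : (0 <= m)%E.
  apply: ess_sup_gee; first by rewrite leb01_setT.
  by apply: ae_leb01 => t t01; rewrite lee_fin f0.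
have mM : (m <= M%:E)%E.
  by apply/ess_supP; apply: ae_leb01S fM => t _; rewrite lee_fin.
have mE : m = (fine m)%:E by rewrite fineK// ge0_fin_numE// (le_lt_trans mM)// ltry.
have fm : \forall t \ae leb01 R, f t <= fine m.
  have := ess_sup_ge (leb01 R) (EFin \o f); apply: ae_leb01S => t _.
  by rewrite -/m mE lee_fin.
have fm0 : 0 <= fine m by exact: fine_ge0.
exists (fine m); have [m00|m_gt0] := eqVneq (fine m) 0.
  exists `]0, 1]%classic; split => //; first by split.
    by rewrite lebesgue_measure_itv/= lte_fin ltr01 oppr0 adde0 lte01.
  by move=> t /=; rewrite in_itv/= m00 mul0r; exact: f0.
have m_pos : 0 < fine m by rewrite lt_neqAle eq_sym m_gt0.
have mf' : measurable_fun (`]0, 1] : set R) f.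
  by apply: measurable_funS mf => //; apply: subset_itvr; rewrite bnd_simp.
pose E := (`]0, 1]%classic `&` f @^-1` `[fine m / 2, +oo[%classic) : set R.
have mmE : measurable E by apply: mf' => //; exact: measurable_itv.
exists E; split => //.
- by split => // t [].
- rewrite lt_neqAle measure_ge0 andbT eq_sym; apply/negP => /eqP E0.
  have : (m <= (fine m / 2)%:E)%E.
    apply/ess_supP => //=; apply/ae_leb01P; exists E; split => // t /= [t01].
    rewrite lee_fin => /negP; rewrite -ltNge => ft.
    by split; rewrite /= in_itv/= ?t01// andbT ltW.
  by rewrite mE lee_fin /= => h; move: m_pos h; lra.
- by move=> t [_] /=; rewrite in_itv/= andbT.
Qed.

Lemma bounded_integral (E : set R) f c : measurable E -> E `<=` `]0, 1] ->
  measurable_fun E f -> 0 <= c ->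
  (\forall t \ae leb01 R, E t -> `|f t| <= c) ->
  mu.-integrable E (EFin \o f) /\ `|\int[mu]_(t in E) f t| <= c * fine (mu E).
Proof.
move=> mE E01 mf c0 fc.
have le : (\int[mu]_(t in E) `|(f t)%:E| <= c%:E * mu E)%E.
  rewrite -integral_cst//; apply: ae_ge0_le_integral => //.
  - by apply: measurableT_comp => //; exact/measurable_EFinP.
  - have /ae_leb01P[A [mA A0 nA]] := fc; exists A; split => // t /= nt.
    apply: nA => /=; split.
      have [Et|nE] := pselect (E t); first by move: (E01 _ Et); rewrite /= in_itv.
      by exfalso; apply: nt.
    by move=> h; apply: nt => Et; rewrite lee_fin; exact: h.
have fE : (mu E < +oo)%E.
  apply: (@le_lt_trans _ _ (mu `]0%R, 1%R])).
    by apply: le_measure; rewrite ?inE//; exact: measurable_itv.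
  by rewrite lebesgue_measure_itv/= lte_fin ltr01 oppr0 adde0 ltry.
have fE' : mu E \is a fin_num by rewrite ge0_fin_numE.
have fi : mu.-integrable E (EFin \o f).
  apply/integrableP; split; first exact/measurable_EFinP.
  apply: le_lt_trans le _; rewrite -(fineK fE') -EFinM; exact: ltry.
split => //; rewrite -lee_fin EFin_normr_Rintegral// EFinM fineK//.
apply: le_trans (le_abse_integral _ _ _) le => //; exact/measurable_EFinP.
Qed.

End Linfty.

(** * Averaging operators bounded on both endpoint spaces *)

Section sampling_operator.
Context {R : realType}.
Local Notation mu := (@lebesgue_measure R).
Implicit Types (f g : R -> R) (c s t : R) (n : nat).

(** For t = 1 / n this is min(1, t / s), the kernel whose supremum against |f s| over s is the least
    quasi-concave majorant of |f|. *)
Definition sampling_weight n s : R := Num.min 1 (n%:R * s)^-1.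

Lemma sampling_weight_ge0 n s : 0 < s -> 0 <= sampling_weight n s.
Proof. by move=> s0; rewrite le_min ler01 invr_ge0 mulr_ge0// ltW. Qed.

Lemma sampling_weight_le1 n s : sampling_weight n s <= 1.
Proof. by rewrite ge_min lexx. Qed.

Lemma sampling_weight_le n s : 0 < s -> (0 < n)%N ->
  sampling_weight n s * s <= n%:R^-1.
Proof.
move=> s0 n0; have nR : 0 < n%:R :> R by rewrite ltr0n.
apply: (@le_trans _ _ ((n%:R * s)^-1 * s)).
  by rewrite ler_wpM2r ?(ltW s0)// ge_min lexx orbT.
by rewrite invfM -mulrA mulVf ?mulr1// gt_eqF.
Qed.

Lemma sampling_weight_max n s : 0 < s -> (0 < n)%N ->
  Num.max 1 (n%:R * s) * sampling_weight n s = 1.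
Proof.
move=> s0 n0; have ns0 : 0 < n%:R * s by rewrite mulr_gt0// ltr0n.
rewrite /sampling_weight; case: (leP (n%:R * s) 1) => ns.
  by rewrite mul1r; apply/min_idPl; rewrite invf_ge1.
rewrite (min_idPr _); first by rewrite mulfV// gt_eqF.
by rewrite invf_le1// ltW.
Qed.

Lemma measurable_sampling_weight n (E : set R) : measurable E ->
  E `<=` `]0, 1] -> measurable_fun E (sampling_weight n).
Proof.
move=> mE E01; apply: measurable_minr => //.
apply: (@eq_measurable_fun _ _ _ _ _ (fun s => n%:R^-1 * s^-1)).
  by move=> s _; rewrite invfM.
apply: measurable_funM => //; apply: measurable_fun_invr => //.
by move=> s /E01 /=; rewrite !in_itv/= andbT => /andP[/ltW].
Qed.

Lemma truncn_inv_gt0 t : 0 < t <= 1 -> (0 < Num.truncn t^-1)%N.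
Proof. by move=> /andP[t0 t1]; rewrite truncn_gt0 invf_ge1. Qed.

Lemma truncn_inv_le1 t : 0 < t <= 1 -> (Num.truncn t^-1)%:R * t <= 1.
Proof.
move=> /andP[t0 t1]; rewrite -ler_pdivlMr// mul1r.
by rewrite truncn_le invr_ge0 ltW.
Qed.

Lemma truncn_inv_ge t : 0 < t <= 1 -> (Num.truncn t^-1)%:R^-1 <= 2 * t.
Proof.
move=> t01; have /andP[t0 t1] := t01; have n0 := truncn_inv_gt0 t01.
have nR : 0 < (Num.truncn t^-1)%:R :> R by rewrite ltr0n.
rewrite -[leRHS]invrK lef_pV2 ?posrE ?invr_gt0 ?mulr_gt0// invfM mulrC.
rewrite ler_pdivrMr//; apply: le_trans (ltW (truncnS_gt _)) _.
rewrite -natrM ler_nat; move: n0; case: (Num.truncn _) => [|k _]; first by [].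
by lia.
Qed.

(* For t close to 1 / n, sampling g t averages min(1, 1 / (n s)) g(s) over E n.
   The weight makes it bounded on both endpoint spaces whatever E is, and E n
   will be a set where the weighted |f| is at least half its essential
   supremum. *)
Variable E : nat -> set R.
Hypotheses (mE : forall n, measurable (E n)) (E01 : forall n, E n `<=` `]0, 1])
  (E0 : forall n, (0 < mu (E n))%E).

Definition sampling g t : R := let n := Num.truncn t^-1 in
  (fine (mu (E n)))^-1 * \int[mu]_(s in E n) (sampling_weight n s * g s).

Let muE0 n : 0 < fine (mu (E n)).
Proof.
rewrite fine_gt0// E0/=; apply: (@le_lt_trans _ _ (mu `]0%R, 1%R])).
  by apply: le_measure; rewrite ?inE; [exact: mE|exact: measurable_itv|exact: E01].
by rewrite lebesgue_measure_itv/= lte_fin ltr01 oppr0 adde0 ltry.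
Qed.

Let measurable_weighted n g : measurable01 g ->
  measurable_fun (E n) (fun s => sampling_weight n s * g s).
Proof.
move=> mg; apply: measurable_funM.
  exact: (measurable_sampling_weight n (mE n) (@E01 n)).
apply: measurable_funS mg => //; apply: (subset_trans (@E01 n)).
by apply: subset_itvr; rewrite bnd_simp.
Qed.

Lemma integrable_weighted n g : (Linfty_norm g < +oo)%E ->
  mu.-integrable (E n) (EFin \o (fun s => sampling_weight n s * g s)).
Proof.
move=> goo; have := Linfty_norm_finE goo; set M := fine _ => gM.
have [mg ag] : measurable01 g /\ \forall t \ae leb01 R, `|g t| <= M.
  by apply/Linfty_norm_leP; rewrite gM.
apply: (proj1 (bounded_integral (c := M) _ _ _ _ _)) => //.
- exact: measurable_weighted.
- by apply: fine_ge0; exact: Linfty_norm_ge0.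
apply: ae_leb01S ag => t /andP[t0 _] gt _; rewrite normrM.
rewrite ger0_norm ?sampling_weight_ge0//; apply: le_trans gt.
by rewrite ler_piMl// sampling_weight_le1.
Qed.

Lemma sampling_le g c t : measurable01 g -> 0 <= c ->
  (\forall s \ae leb01 R,
    sampling_weight (Num.truncn t^-1) s * `|g s| <= c) ->
  `|sampling g t| <= c.
Proof.
move=> mg c0 gc; rewrite /sampling; set n := Num.truncn _.
have [|_] := @bounded_integral R (E n) (fun s => sampling_weight n s * g s) c
  (mE n) (@E01 n) (@measurable_weighted n g mg) c0.
  apply: ae_leb01S gc => s /andP[s0 _] h _.
  by rewrite normrM ger0_norm ?sampling_weight_ge0.
by move=> h; rewrite normrM gtr0_norm ?invr_gt0// mulrC ler_pdivrMr.
Qed.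

Lemma le_sampling g c t : (Linfty_norm g < +oo)%E ->
  (forall s, E (Num.truncn t^-1) s ->
    c <= sampling_weight (Num.truncn t^-1) s * g s) ->
  c <= sampling g t.
Proof.
move=> goo gc; rewrite /sampling; set n := Num.truncn _.
rewrite mulrC ler_pdivlMr//.
have <- : \int[mu]_(s in E n) c = c * fine (mu (E n)).
  by rewrite Rintegral_cst//; exact: mE.
apply: le_Rintegral; [exact: mE| |exact: integrable_weighted|exact: gc].
apply: (proj1 (bounded_integral (c := `|c|) _ _ _ _ _)) => //.
exact: ae_leb01.
Qed.

(** The function depends on t only through the integer part of 1 / t, so a preimage is a countable
    union of measurable pieces. *)
Lemma measurable01_sampling g : measurable01 (sampling g).
Proof.
move=> _ Y mY; pose A n := `[0, 1]%classic `&`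
  (fun t : R => t^-1) @^-1` `[n%:R, n.+1%:R[%classic.
pose v n := (fine (mu (E n)))^-1 * \int[mu]_(s in E n) (sampling_weight n s * g s).
rewrite (_ : _ `&` _ = \bigcup_(n in v @^-1` Y) A n).
  apply: bigcup_measurable => n _; apply: measurable_fun_invr => //.
  by apply: subset_itvl; rewrite bnd_simp.
apply/seteqP; split => [t [t01 Yt]|t [n Yn [t01 tn]]].
  exists (Num.truncn t^-1) => //; split => //.
  rewrite /= in_itv/=; apply: truncn_itv; rewrite invr_ge0.
  by move: t01; rewrite /= in_itv/= => /andP[].
split => //; move: tn; rewrite /= in_itv/= => /truncn_def tn.
by rewrite /sampling tn.
Qed.

Lemma linear_sampling : linear_on_Linfty sampling.
Proof.
move=> a f g foo goo; apply: ae_leb01 => t _ _.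
rewrite /sampling; set n := Num.truncn _.
have fi := integrable_weighted n foo; have gi := integrable_weighted n goo.
rewrite (_ : (fun s => _) = (fun s => a * (sampling_weight n s * f s) +
    sampling_weight n s * g s)); last by apply/funext => s; ring.
rewrite RintegralD; [|exact: mE| |exact: gi]; last first.
  rewrite (_ : _ \o _ = (fun s => a%:E * (sampling_weight n s * f s)%:E)%E)//.
  by apply: integrableZl => //; exact: mE.
rewrite RintegralZl; [by ring|exact: mE|exact: fi].
Qed.

Lemma bounded_sampling_Linfty : bounded_on Linfty_norm sampling.
Proof.
exists 1 => g goo; have := Linfty_norm_finE goo; set M := fine _ => gM.
have [mg ag] : measurable01 g /\ \forall t \ae leb01 R, `|g t| <= M.
  by apply/Linfty_norm_leP; rewrite gM.
rewrite mul1e gM; apply/Linfty_norm_leP; split; first exact: measurable01_sampling.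
apply: ae_leb01 => t _; apply: sampling_le => //.
  by apply: fine_ge0; exact: Linfty_norm_ge0.
apply: ae_leb01S ag => s /andP[s0 _] gs; apply: le_trans gs.
by rewrite ler_piMl// sampling_weight_le1.
Qed.

(** If |g s| <= M s, the weighted function is at most M / n, and 1 / n <= 2 t for n the integer part
    of 1 / t. *)
Lemma bounded_sampling_Linfty_inv : bounded_on (@Linfty_inv_norm R) sampling.
Proof.
exists 2 => g goo; have := Linfty_norm_finE goo; set M := fine _ => gM.
have [mg ag] : measurable01 (fun t => g t / t) /\
    \forall t \ae leb01 R, `|g t / t| <= M.
  by apply/Linfty_norm_leP; rewrite gM.
have M0 : 0 <= M by apply: fine_ge0; exact: Linfty_norm_ge0.
have mg' : measurable01 g.
  have U : `[0, 1]%classic = [set 0] `|` `]0, 1]%classic :> set R.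
    by rewrite setU1itv ?bnd_simp// ler01.
  rewrite /measurable01 U; apply/measurable_funU => //.
  split; first exact: measurable_fun_set1.
  apply: (@eq_measurable_fun _ _ _ _ _ (fun t => g t / t * t)).
    move=> t; rewrite inE/= in_itv/= => /andP[t0 t1].
    by rewrite divfK// gt_eqF.
  apply: measurable_funM => //; apply: measurable_funS mg => //.
  by apply: subset_itvr; rewrite bnd_simp.
rewrite /Linfty_inv_norm gM -EFinM; apply/Linfty_norm_leP; split.
  apply: measurable_funM; first exact: measurable01_sampling.
  by apply: measurable_fun_invr => //; apply: subset_itvl; rewrite bnd_simp.
apply: ae_leb01 => t t01; have /andP[t0 t1] := t01.
have n0 := truncn_inv_gt0 t01.
rewrite normrM normfV (gtr0_norm t0) ler_pdivrMr// (mulrC 2) -mulrA.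
apply: (@le_trans _ _ (M * (Num.truncn t^-1)%:R^-1)); last first.
  by rewrite ler_wpM2l// truncn_inv_ge.
apply: sampling_le => //; first by rewrite mulr_ge0.
apply: ae_leb01S ag => s /andP[s0 _].
rewrite normrM normfV (gtr0_norm s0) ler_pdivrMr// => gs.
apply: (@le_trans _ _ (sampling_weight (Num.truncn t^-1) s * (M * s))).
  by rewrite ler_wpM2l// sampling_weight_ge0.
by rewrite mulrCA ler_wpM2l// sampling_weight_le.
Qed.

End sampling_operator.

(** * Existence and uniform control of the majorants *)

Section lattice_majorant.
Context {R : realType} (F : banach_lattice01 R).
Implicit Types (f g eta : R -> R) (a c s t : R).

Lemma lattice_le f g : measurable01 f ->
  (forall t, 0 < t <= 1 -> `|f t| <= `|g t|) -> (F f <= F g)%E.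
Proof. by move=> mf fg; apply: lattice_ideal => //; exact: ae_leb01. Qed.

Lemma lattice_norm0 : F (cst 0) = 0%E.
Proof.
have := lattice_scale F 0 (cst 0); rewrite normr0 mul0e => <-.
by congr (lattice_norm F _); apply/funext => t; rewrite mul0r.
Qed.

Lemma lattice_normN f : F (- f) = F f.
Proof.
have := lattice_scale F (-1) f; rewrite normrN1 mul1e => <-.
by congr (lattice_norm F _); apply/funext => t; rewrite mulN1r.
Qed.

Lemma lattice_norm_scale a f : 0 <= a -> F (fun t => a * f t) = (a%:E * F f)%E.
Proof. by move=> a0; rewrite lattice_scale ger0_norm. Qed.

Lemma lattice_norm_fineK f : (F f < +oo)%E -> F f = (fine (F f))%:E.
Proof. by move=> foo; rewrite fineK// ge0_fin_numE// lattice_ge0. Qed.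

Lemma lattice_norm_normr f : measurable01 f -> F (fun t => `|f t|)%R = F f.
Proof.
move=> mf; apply/eqP; rewrite eq_le; apply/andP; split.
- apply: lattice_le; first exact: measurableT_comp.
  by move=> t _; rewrite normr_id.
- by apply: lattice_le => // t _; rewrite normr_id.
Qed.

Hypothesis hF : interpolation_lattice F.

(** Let m n be the essential supremum of the weighted |f|. As max(1, n t) inverts the weight, |f t|
    <= max(1, n t) m n a.e., simultaneously for all n since they are countably many; eta is the
    infimum of these bounds, and an infimum of quasi-concave functions is quasi-concave. For n the
    integer part of 1 / t, n t <= 1 gives eta t <= m n, at most twice the average of the weighted
    |f| over E n. *)
Lemma quasiconcave_majorant_exists f : (F f < +oo)%E ->
  exists eta, [/\ quasiconcave eta, \forall t \ae leb01 R, `|f t| <= eta t &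
    (F eta < +oo)%E].
Proof.
move=> foo; have mf := lattice_measurable foo.
have [_ [C0 hC] hT] := hF.
have fLoo : (Linfty_norm f < +oo)%E.
  apply: le_lt_trans (hC _ foo) _.
  by rewrite (lattice_norm_fineK foo) -EFinM ltry.
have := Linfty_norm_finE fLoo; set M := fine _ => fM.
have [_ af] : measurable01 f /\ \forall t \ae leb01 R, `|f t| <= M.
  by apply/Linfty_norm_leP; rewrite fM.
have mabs : measurable01 (fun t => `|f t|)%R by exact: measurableT_comp.
have D01 : (`]0, 1]%classic : set R) `<=` `[0, 1].
  by apply: subset_itvr; rewrite bnd_simp.
pose h n s := Num.max 0 (sampling_weight n s) * `|f s|.
have hE n s : 0 < s -> h n s = sampling_weight n s * `|f s|.
  by move=> s0; rewrite /h (max_idPr _)// sampling_weight_ge0.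
have mh n : measurable01 (h n).
  have U : `[0, 1]%classic = [set 0] `|` `]0, 1]%classic :> set R.
    by rewrite setU1itv ?bnd_simp// ler01.
  rewrite /measurable01 U; apply/measurable_funU => //.
  split; first exact: measurable_fun_set1.
  apply: measurable_funM; last exact: measurable_funS mabs.
  apply: measurable_maxr => //; exact: measurable_sampling_weight.
have h_half n := ess_sup_half (mh n) (M := M).
have /choice[m /choice[E hE']] n : exists (m : R) (E : set R), [/\ 0 <= m,
    \forall t \ae leb01 R, h n t <= m,
    measurable E /\ E `<=` `]0, 1], (0 < lebesgue_measure E)%E &
    forall t, E t -> m / 2 <= h n t].
  apply: (h_half n).
    by move=> t /andP[t0 _]; rewrite mulr_ge0// le_max lexx.
  apply: ae_leb01S af => t /andP[t0 _] ft; rewrite hE//; apply: le_trans ft.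
  by rewrite ler_piMl// sampling_weight_le1.
have m0 n : 0 <= m n by have [] := hE' n.
have mE n : measurable (E n) by have [_ _ []] := hE' n.
have E01 n : E n `<=` `]0, 1] by have [_ _ []] := hE' n.
have E0 n : (0 < lebesgue_measure (E n))%E by have [] := hE' n.
(* Indices start at 1: the weight for n = 0 vanishes and has no inverse. *)
pose A t := [set Num.max 1 (n.+1%:R * t) * m n.+1 | n in [set: nat]].
have A0 t : A t !=set0 by exists (Num.max 1 (1%:R * t) * m 1); exists 0.
have Age0 t : lbound (A t) 0.
  by move=> _ [n _ <-]; rewrite mulr_ge0// le_max ler01.
pose eta t := inf (A t).
have eta_le t n : eta t <= Num.max 1 (n.+1%:R * t) * m n.+1.
  by apply: ge_inf; [exists 0; exact: Age0|exists n].
have le_eta t x : (forall n, x <= Num.max 1 (n.+1%:R * t) * m n.+1) -> x <= eta t.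
  by move=> le; apply: lb_le_inf => // _ [n _ <-].
have qeta : quasiconcave eta.
  move=> s t s0 st t1; have t0 := lt_le_trans s0 st; split.
  - by apply: le_eta => n; rewrite mulr_ge0// le_max ler01.
  - apply: le_eta => n; apply: le_trans (eta_le s n) _; rewrite ler_wpM2r//.
    by rewrite ge_max !le_max lexx ler_wpM2l// orbT.
  - have st0 : 0 <= s / t by rewrite divr_ge0// ltW.
    suff : s / t * eta t <= eta s by rewrite mulrAC ler_pdivrMr// (mulrC _ t).
    apply: le_eta => n; apply: le_trans (ler_wpM2l st0 (eta_le t n)) _.
    rewrite mulrA ler_wpM2r// maxr_pMr// mulr1 mulrCA divfK ?gt_eqF//.
    rewrite ge_max !le_max lexx orbT andbT.
    by rewrite ler_pdivrMr// mul1r st.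
exists eta; split => //.
- have /ae_foralln : forall n, \forall t \ae leb01 R, h n.+1 t <= m n.+1.
    by move=> n; have [] := hE' n.+1.
  apply: ae_leb01S => t /andP[t0 _] ht; apply: le_eta => n.
  rewrite -[leLHS]mul1r -[X in X * _ <= _](sampling_weight_max t0 (ltn0Sn n)).
  by rewrite -mulrA ler_wpM2l ?le_max ?ler01// -hE.
- have [C HC] := hT _ (linear_sampling mE E01) (bounded_sampling_Linfty mE E01 E0)
    (bounded_sampling_Linfty_inv mE E01 E0).
  have absoo : (F (fun t => `|f t|)%R < +oo)%E by rewrite lattice_norm_normr.
  have Soo := HC _ absoo.
  have absLoo : (Linfty_norm (fun t => `|f t|)%R < +oo)%E.
    apply: le_lt_trans (ltry M); apply/Linfty_norm_leP; split => //.
    by apply: ae_leb01S af => t _; rewrite normr_id.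
  apply: (@le_lt_trans _ _ (F (fun t => 2 * sampling E (fun t => `|f t|) t)%R)).
    apply: lattice_le; first exact: quasiconcave_measurable.
    move=> t t01; rewrite !ger0_norm ?(quasiconcave_ge0 qeta)//; last first.
      rewrite mulr_ge0//; apply: le_sampling => // s Es.
      have /andP[s0 _] : 0 < s <= 1 by have := E01 _ _ Es; rewrite /= in_itv.
      by rewrite mulr_ge0// sampling_weight_ge0.
    have := truncn_inv_gt0 t01; case nE : (Num.truncn t^-1) => [//|n] _.
    have := truncn_inv_le1 t01; rewrite nE => nt1.
    apply: le_trans (eta_le t n) _; rewrite (max_idPl nt1) mul1r.
    rewrite -ler_pdivrMl// mulrC; apply: le_sampling => // s; rewrite nE => Es.
    have /andP[s0 _] : 0 < s <= 1 by have := E01 _ _ Es; rewrite /= in_itv.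
    by rewrite -hE//; have [_ _ _ _] := hE' n.+1; apply.
  rewrite lattice_norm_scale//; apply: lte_mul_pinfty => //.
  apply: le_lt_trans Soo _; rewrite (lattice_norm_fineK absoo) -EFinM.
  exact: ltry.
Qed.

(* Gliding hump: a sum of normalised functions violating the bound more and
   more would have no majorant in F. *)
Lemma quasiconcave_majorant : exists2 C, 0 < C & forall f, (F f < +oo)%E ->
  exists eta, [/\ quasiconcave eta, \forall t \ae leb01 R, `|f t| <= eta t &
    (F eta <= C%:E * F f)%E].
Proof.
apply: contrapT => noC.
have /choice[f Hf] n : exists f, (F f < +oo)%E /\ forall eta, quasiconcave eta ->
    (\forall t \ae leb01 R, `|f t| <= eta t) -> ((4 ^+ n)%:E * F f < F eta)%E.
  apply: contrapT => nof; apply: noC; exists (4 ^+ n); first by rewrite exprn_gt0.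
  move=> f foo; apply: contrapT => noeta; apply: nof; exists f.
  split => // eta qeta feta.
  by rewrite ltNge; apply/negP => le; apply: noeta; exists eta.
have foo n : (F (f n) < +oo)%E by have [] := Hf n.
pose r n := fine (F (f n)).
have rE n : F (f n) = (r n)%:E by exact: lattice_norm_fineK.
(* If the norm of f n were 0, then 0 would be a quasi-concave majorant a.e., contradicting the
   strict inequality. *)
have r0 n : 0 < r n.
  rewrite lt_neqAle fine_ge0 ?lattice_ge0// andbT eq_sym; apply/negP => /eqP rn0.
  have fn0 : F (f n) = 0%E by rewrite rE rn0.
  have [_ /(_ (cst 0))] := Hf n; rewrite fn0 mule0 lattice_norm0 ltxx.
  move=> h; suff : false by []; apply: h.
  - by move=> s t _ _ _; rewrite /= !mulr0.
  - have := lattice_eq0 fn0; apply: ae_leb01S => t _ /(_ I) -> /=.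
    by rewrite normr0.
(* The norm of g n is 2^-n, summable, yet 2^n short of compensating the failure factor 4^n. *)
pose g n t := (2 ^+ n * r n)^-1 * `|f n t|.
have c0 n : 0 < 2 ^+ n * r n by rewrite mulr_gt0// exprn_gt0.
have g0 n t : 0 <= g n t by rewrite mulr_ge0// invr_ge0 ltW.
have Fg n : F (g n) = (2^-1 ^+ n)%:E.
  rewrite lattice_norm_scale; last by rewrite invr_ge0 ltW.
  rewrite lattice_norm_normr; last exact: lattice_measurable (foo n).
  rewrite rE -EFinM invfM -mulrA mulVf ?gt_eqF// mulr1.
  by rewrite exprVn.
pose u n t := \sum_(i < n) g i t.
have uS n : u n.+1 = u n + g n by apply/funext => t; rewrite /u big_ord_recr.
have u0 : u 0 = cst 0 by apply/funext => t; rewrite /u big_ord0.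
have und n k t : u n t <= u (n + k)%N t.
  elim: k => [|k IH]; first by rewrite addn0.
  by rewrite addnS uS; apply: le_trans IH _; rewrite lerDl.
have du n k : (F (u (n + k)%N - u n)%R <=
    (2 * 2^-1 ^+ n - 2 * 2^-1 ^+ (n + k))%:E)%E.
  elim: k => [|k IH].
    rewrite addn0 !subrr (_ : 0%R = cst 0) ?lattice_norm0//.
  rewrite addnS uS addrAC; apply: le_trans (lattice_add F _ _) _.
  apply: le_trans (leeD IH (lexx _)) _; rewrite Fg -EFinD lee_fin exprS.
  by lra.
have uoo n : (F (u n) < +oo)%E.
  have := du 0%N n; rewrite add0n u0 => /le_lt_trans.
  rewrite (_ : u n - cst 0 = u n).
    by apply; exact: ltry.
  by apply/funext => t /=; rewrite /GRing.add/= /GRing.opp/= subr0.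
have pow2 n : n%:R < 2 ^+ n :> R by rewrite -natrX ltr_nat ltn_expl.
have half_small (e : R) : 0 < e ->
    exists n0, forall n, (n0 <= n)%N -> 2 * 2^-1 ^+ n < e.
  move=> e0; exists (Num.truncn (2 / e)).+1 => n le; rewrite exprVn.
  rewrite ltr_pdivrMr ?exprn_gt0// mulrC -ltr_pdivrMr//.
  apply: lt_trans (pow2 n); apply: lt_le_trans (truncnS_gt _) _.
  by rewrite ler_nat.
have [h hoo uh] : exists2 h, (F h < +oo)%E &
    (fun n => F (u n - h)) @ \oo --> 0%E.
  apply: lattice_complete => // e e0; have [n0 Hn0] := half_small e e0.
  have key n k : (n0 <= n)%N -> (F (u (n + k)%N - u n)%R < e%:E)%E.
    move=> /Hn0 le; apply: le_lt_trans (du n k) _; rewrite lte_fin.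
    by apply: le_lt_trans le; rewrite gerBl mulr_ge0// exprn_ge0// invr_ge0.
  exists n0 => m n mn0 nn0; have [nm|mn] := leqP n m.
    by rewrite -(subnKC nm); exact: key.
  rewrite -opprB lattice_normN -(subnKC (ltnW mn)); exact: key.
have mh := lattice_measurable hoo.
(* The partial sums increase, so the positive part of u n - h is at most |u m - h| for all m >= n;
   its norm is therefore 0. *)
have uleh n : \forall t \ae leb01 R, u n t <= h t.
  have mu_ k := lattice_measurable (uoo k).
  pose d t := Num.max 0 (u n t - h t).
  have md : measurable01 d.
    apply: measurable_maxr => //; exact: (measurable_funB (mu_ n) mh).
  have d0 : F d = 0%E.
    apply/eqP; rewrite eq_le lattice_ge0 andbT.
    apply: (cvge_to_ge uh); exists n => // m /= nm.
    apply: lattice_le => // t _; rewrite ger0_norm ?le_max ?lexx//.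
    rewrite ge_max normr_ge0/=; apply: le_trans (ler_norm _).
    rewrite -(subnKC nm) /GRing.add/= /GRing.opp/=.
    by rewrite lerB// und.
  have := lattice_eq0 d0; apply: ae_leb01S => t _ /(_ I) /= dt.
  have : u n t - h t <= d t by rewrite le_max lexx orbT.
  by rewrite dt subr_le0.
have [eta [qeta heta etaoo]] := quasiconcave_majorant_exists hoo.
(* 2^n r n eta majorises |f n|, so the choice of f n gives 4^n r n < 2^n r n F(eta). *)
have big n : 2 ^+ n < fine (F eta).
  have [_ /(_ (fun t => (2 ^+ n * r n) * eta t))] := Hf n.
  rewrite lattice_norm_scale; last exact: ltW.
  rewrite rE (lattice_norm_fineK etaoo) -!EFinM lte_fin.
  have -> : 4 ^+ n * r n = (2 ^+ n * r n) * 2 ^+ n.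
    by rewrite mulrAC -exprMn -natrM.
  rewrite ltr_pM2l//; apply; first by apply: quasiconcave_scale => //; exact: ltW.
  have := ae_leb01I heta (uleh n.+1); apply: ae_leb01S => t _ [ht ut].
  rewrite -ler_pdivrMl//; apply: le_trans ht; apply: le_trans (ler_norm _).
  apply: le_trans ut; rewrite uS /GRing.add/= lerDr.
  by rewrite /u sumr_ge0.
have := lt_trans (pow2 _) (big (Num.truncn (fine (F eta))).+1).
by rewrite ltNge (ltW (truncnS_gt _)).
Qed.

End lattice_majorant.

(** * Dilations of quasi-concave functions and the K-method *)

Section dilation_bounded.
Context {R : realType} (F : banach_lattice01 R).
Hypothesis hF : interpolation_lattice F.
Implicit Types (f g eta : R -> R) (a b c s t : R).

(** A dilation with a > 1 need not preserve quasi-concavity; asking for a quasi-concave majorant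
    makes the property stable under composition. *)
Definition dilation_bounded a : Prop := exists2 C, 0 < C &
  forall eta, quasiconcave eta -> (F eta < +oo)%E -> exists eta',
    [/\ quasiconcave eta',
        forall t, 0 < t <= 1 -> power_dilation a eta t <= eta' t &
        (F eta' <= C%:E * F eta)%E].

Lemma ae_leb01_exists (P : R -> Prop) a b : (\forall t \ae leb01 R, P t) ->
  0 < a -> a < b -> b <= 1 -> exists2 t, a < t < b & P t.
Proof.
move=> /ae_leb01P nP a0 ab b1; apply: contrapT => no.
have sub : `]a, b[%classic `<=` [set t | 0 < t <= 1 /\ ~ P t].
  move=> t /=; rewrite in_itv/= => /andP[at_ tb]; split.
    by rewrite (lt_trans a0 at_) (ltW (lt_le_trans tb b1)).
  by move=> Pt; apply: no; exists t => //; rewrite at_.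
have nI : (@lebesgue_measure R).-negligible `]a, b[%classic.
  exact: negligibleS nP.
have : lebesgue_measure (`]a, b[%classic : set R) = 0%E.
  by apply/negligibleP => //; exact: measurable_itv.
rewrite lebesgue_measure_itv/= lte_fin ab -EFinD => -[] /eqP.
by rewrite subr_eq0 gt_eqF.
Qed.

(** Some s in (t / 2, t) satisfies the a.e. inequality, and then g t <= (t / s) g s <= 2 eta s <= 2
    eta t. *)
Lemma ae_le_quasiconcave g eta : quasiconcave eta ->
  (forall s t, 0 < s -> s <= t -> t <= 1 -> s * g t <= t * g s) ->
  (\forall t \ae leb01 R, g t <= eta t) ->
  forall t, 0 < t <= 1 -> g t <= 2 * eta t.
Proof.
move=> qeta gd ge t /andP[t0 t1].
have t20 : 0 < t / 2 by rewrite divr_gt0.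
have t2t : t / 2 < t by lra.
have [s /andP[ts st] gs] := ae_leb01_exists ge t20 t2t t1.
have s0 := lt_trans t20 ts.
have [e0 est _] := qeta s t s0 (ltW st) t1.
have := gd s t s0 (ltW st) t1 => h.
rewrite -(ler_pM2l s0); apply: le_trans h _.
apply: (@le_trans _ _ (t * eta t)); first by rewrite ler_pM2l// (le_trans gs).
by rewrite mulrA ler_wpM2r ?(le_trans e0)//; lra.
Qed.

Lemma measurable01_square_operator f : measurable01 f ->
  measurable01 (square_operator f).
Proof.
move=> mf.
have mi : measurable01 (fun t : R => t^-1).
  by apply: measurable_fun_invr => //; apply: subset_itvl; rewrite bnd_simp.
have sub : (fun t : R => t ^+ 2) @` `[0, 1]%classic `<=` `[0, 1]%classic.
  move=> _ [t /= + <-]; rewrite !in_itv/= => /andP[t0 t1].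
  by rewrite exprn_ge0// exprn_ile1.
have mc : measurable01 (f \o (fun t : R => t ^+ 2)).
  have ms : measurable_fun (`[0, 1]%classic : set R) (fun t : R => t ^+ 2).
    exact: exprn_measurable.
  exact: (measurable_comp (measurable_itv _) sub mf ms).
exact: measurable_funM mc mi.
Qed.

Lemma dilation_bounded2 : bounded_on F square_operator -> dilation_bounded 2.
Proof.
move=> [C HC]; have [C1 C10 HC1] := quasiconcave_majorant hF.
(* [bounded_on] puts no sign on C, while a positive constant is required; the 2 is the price of
   passing from a.e. to everywhere. *)
exists (2 * (C1 * (`|C| + 1))).
  by rewrite !mulr_gt0// ltr_wpDl.
move=> eta qeta etaoo; have le := HC _ etaoo.
have le' : (F (square_operator eta) <= (`|C| + 1)%:E * F eta)%E.
  apply: le_trans le _; rewrite lee_wpmul2r ?lattice_ge0// lee_fin.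
  by rewrite (le_trans (ler_norm _))// lerDl.
have soo : (F (square_operator eta) < +oo)%E.
  by apply: le_lt_trans le' _; rewrite (lattice_norm_fineK etaoo) -EFinM ltry.
have [eta1 [qeta1 le1 Fle1]] := HC1 _ soo.
exists (fun t => 2 * eta1 t); split.
- exact: quasiconcave_scale.
- apply: ae_le_quasiconcave => //; first by move=> s t; exact: power_dilation_div.
  apply: ae_leb01S le1 => t /andP[t0 t1]; rewrite power_dilation2//.
  by apply: le_trans; exact: ler_norm.
- rewrite lattice_norm_scale// EFinM -muleA lee_wpmul2l//.
  apply: le_trans Fle1 _; rewrite EFinM -muleA lee_wpmul2l// lee_fin ltW//.
Qed.

(** A general f is replaced by a quasi-concave majorant eta; |f| <= eta a.e. remains true after t is
    replaced by t ^+ 2. *)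
Lemma bounded_square_operator :
  dilation_bounded 2 -> bounded_on F square_operator.
Proof.
move=> [C C0 HC]; have [C1 C10 HC1] := quasiconcave_majorant hF.
exists (C * C1) => f foo; have mf := lattice_measurable foo.
have [eta [qeta le Fle]] := HC1 _ foo.
have etaoo : (F eta < +oo)%E.
  by apply: le_lt_trans Fle _; rewrite (lattice_norm_fineK foo) -EFinM ltry.
have [eta' [qeta' le' Fle']] := HC _ qeta etaoo.
apply: (@le_trans _ _ (F eta')).
  apply: lattice_ideal; first exact: measurable01_square_operator.
  have := ae_leb01_sqr le; apply: ae_leb01S => t t01; have /andP[t0 t1] := t01.
  rewrite /square_operator normrM normfV (gtr0_norm t0) => h.
  rewrite (ger0_norm (quasiconcave_ge0 qeta' t01)); apply: le_trans (le' _ t01).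
  by rewrite power_dilation2// /square_operator ler_pM2r// invr_gt0.
apply: le_trans Fle' _; rewrite EFinM -muleA lee_wpmul2l// lee_fin.
exact: ltW.
Qed.

Lemma dilation_bounded_mono a b : 0 <= a -> a <= b -> dilation_bounded b ->
  dilation_bounded a.
Proof.
move=> a0 ab [C C0 HC]; exists C => // eta qeta etaoo.
have [eta' [qeta' le Fle]] := HC _ qeta etaoo; exists eta'; split => // t t01.
by apply: le_trans (le _ t01); exact: le_power_dilation.
Qed.

Lemma dilation_boundedM a b : 0 <= b -> dilation_bounded a -> dilation_bounded b ->
  dilation_bounded (b * a).
Proof.
move=> b0 [C C0 HC] [D D0 HD]; exists (D * C); first exact: mulr_gt0.
move=> eta qeta etaoo; have [eta1 [qeta1 le1 Fle1]] := HC _ qeta etaoo.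
have eta1oo : (F eta1 < +oo)%E.
  by apply: le_lt_trans Fle1 _; rewrite (lattice_norm_fineK etaoo) -EFinM ltry.
have [eta2 [qeta2 le2 Fle2]] := HD _ qeta1 eta1oo.
exists eta2; split => //.
- move=> t t01; have /andP[t0 t1] := t01; apply: le_trans (le2 _ t01).
  rewrite -power_dilation_comp// [leLHS]/power_dilation [leRHS]/power_dilation.
  by rewrite ler_wpM2l ?powR_ge0// le1// powR_itv01.
- apply: le_trans Fle2 _; rewrite EFinM -muleA lee_wpmul2l// lee_fin.
  exact: ltW.
Qed.

Lemma dilation_bounded_all a b : 1 < a -> dilation_bounded a ->
  0 <= b -> dilation_bounded b.
Proof.
move=> a1 ba b0; have a0 := lt_trans ltr01 a1.
have bX n : dilation_bounded (a ^+ n).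
  elim: n => [|n IH]; last first.
    by rewrite exprS; apply: dilation_boundedM => //; exact: ltW.
  exists 1 => // eta qeta _; exists eta; split => //; last by rewrite mul1e.
  by move=> t /andP[t0 _]; rewrite expr0 power_dilation1.
(* By Bernoulli's inequality the powers of a exceed any b; [dilation_bounded_mono] then descends to
   b. *)
have bern n : 1 + n%:R * (a - 1) <= a ^+ n.
  elim: n => [|n IH]; first by rewrite mul0r addr0.
  rewrite exprS; apply: (@le_trans _ _ (a * (1 + n%:R * (a - 1)))).
    rewrite -subr_ge0 -natr1 (_ : _ - _ = n%:R * (a - 1) ^+ 2); last by ring.
    by rewrite mulr_ge0// sqr_ge0.
  by rewrite ler_pM2l.
apply: (@dilation_bounded_mono _ (a ^+ (Num.truncn (b / (a - 1))).+1)) => //.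
apply: le_trans (bern _); rewrite ler_wpDl// -ler_pdivrMr ?subr_gt0//.
exact/ltW/truncnS_gt.
Qed.

Lemma K_method_norm_le (V : zmodType) (N0 N1 : V -> \bar R) x eta :
  (forall y, 0 <= N0 y)%E -> (forall y, 0 <= N1 y)%E -> in_sum N0 N1 x ->
  (forall t, 0 < t <= 1 -> fine (K_functional N0 N1 t x) <= eta t) ->
  (K_method_norm F N0 N1 x <= F eta)%E.
Proof.
move=> N00 N10 sx le; rewrite /K_method_norm asboolT//.
have q := quasiconcave_K_functional N00 N10 sx.
apply: lattice_le; first exact: quasiconcave_measurable.
move=> t t01; rewrite ger0_norm; last exact: (quasiconcave_ge0 q).
by apply: le_trans (le _ t01) _; exact: ler_norm.
Qed.

Lemma interpolated_K_method_norm_equiv theta (q : \bar R) :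
  (forall a, 0 <= a -> dilation_bounded a) -> 0 < theta < 1 -> (1 <= q)%E ->
  exists C : R, forall (V : zmodType) (N0 N1 : V -> \bar R),
    ext_seminorm N0 -> ext_seminorm N1 -> (forall x, (N0 x <= N1 x)%E) ->
    norm_equiv_with C (interpolated_K_method_norm F N0 N1 theta q)
      (K_method_norm F N0 N1).
Proof.
move=> ball th q1; have /andP[th0 th1] := th.
pose theta' := (theta + 1) / 2.
have thth' : theta < theta' by rewrite /theta'; lra.
have th1' : theta' < 1 by rewrite /theta'; lra.
have [C C0 HC] := K_functional_interpolation_le th0 thth' th1' q1.
have a0 : 0 <= (1 - theta')^-1 by rewrite invr_ge0 subr_ge0 ltW.
have [D D0 HD] := ball _ a0.
have CD0 : 0 < C * D by exact: mulr_gt0.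
exists (C * D + 4) => V N0 N1 sN0 sN1 N01; split; first by rewrite addr_gt0.
have N00 x : (0 <= N0 x)%E by have [] := sN0.
have N10 x : (0 <= N1 x)%E by have [] := sN1.
have X0 x : (0 <= real_interpolation_norm N0 N1 theta q x)%E.
  exact: real_interpolation_norm_ge0.
have KM0 x : (0 <= K_method_norm F N0 N1 x)%E.
  by rewrite /K_method_norm; case: ifP => // _; exact: lattice_ge0.
have IKM0 x : (0 <= interpolated_K_method_norm F N0 N1 theta q x)%E.
  rewrite /interpolated_K_method_norm /K_method_norm.
  by case: ifP => // _; exact: lattice_ge0.
move=> x; split.
- have [Koo|] := ltP (K_method_norm F N0 N1 x) +oo%E; last first.
    by rewrite leye_eq => /eqP ->; rewrite gt0_muley ?leey// lte_fin addr_gt0.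
  have [sx|nsx] := pselect (in_sum N0 N1 x); last first.
    by move: Koo; rewrite /K_method_norm asboolF.
  have qphi := quasiconcave_K_functional N00 N10 sx.
  move: (Koo); rewrite {1}/K_method_norm asboolT// => phioo.
  have [eta [qeta le Fle]] := HD _ qphi phioo.
  have [sX psile] := HC _ _ _ _ _ sN0 sN1 N01 sx qeta le.
  apply: le_trans (K_method_norm_le X0 N10 sX psile) _.
  rewrite lattice_norm_scale ?(ltW C0)//.
  apply: (@le_trans _ _ ((C * D)%:E * K_method_norm F N0 N1 x)%E).
    rewrite {1}/K_method_norm asboolT// EFinM -muleA lee_wpmul2l// lee_fin.
    exact: ltW.
  by rewrite lee_wpmul2r// lee_fin lerDl.
- rewrite {1}/interpolated_K_method_norm.
  have [sX|nsX] := pselect (in_sum (real_interpolation_norm N0 N1 theta q) N1 x);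
    last first.
    rewrite /interpolated_K_method_norm [in leRHS]/K_method_norm asboolF//.
    by rewrite gt0_muley ?leey// lte_fin addr_gt0.
  have sx := in_sum_interpolation sN0 sN1 N01 th q1 sX.
  have qphi := quasiconcave_K_functional N00 N10 sx.
  apply: (@le_trans _ _ (4%:E * interpolated_K_method_norm F N0 N1 theta q x)%E);
    last by rewrite lee_wpmul2r// lee_fin lerDr ltW.
  rewrite /interpolated_K_method_norm [in leRHS]/K_method_norm asboolT//.
  rewrite -lattice_norm_scale//; apply: K_method_norm_le => // t t01.
  have /andP[t0 t1] := t01.
  have := power_dilation_le_K_functional sN0 sN1 N01 th q1 sX t0.
  apply: le_trans; rewrite -[leLHS](@power_dilation1 _
    (fun t => fine (K_functional N0 N1 t x)))//.
  apply: le_power_dilation => //; rewrite invf_ge1 ?subr_gt0// gerBl.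
  exact: ltW.
Qed.

(** The hypothesis quantified over b says that the pair is rich: up to constants, its K-functionals
    realise every dilation of exponent b < 1 of a quasi-concave function. *)
Lemma dilation_bounded_of_equiv (V : zmodType) (N0 N1 : V -> \bar R)
    theta1 theta2 (q1 q2 : \bar R) :
  ext_seminorm N0 -> ext_seminorm N1 -> (forall x, (N0 x <= N1 x)%E) ->
  (forall b, 0 < b < 1 -> exists2 C, 0 < C & forall eta, quasiconcave eta ->
    exists2 x, in_sum N0 N1 x & forall t, 0 < t <= 1 ->
      power_dilation b eta t <= C * fine (K_functional N0 N1 t x) /\
      fine (K_functional N0 N1 t x) <= C * power_dilation b eta t) ->
  0 < theta1 < 1 -> 0 < theta2 < 1 -> theta1 < theta2 ->
  (1 <= q1)%E -> (1 <= q2)%E ->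
  norm_equiv (interpolated_K_method_norm F N0 N1 theta1 q1)
    (interpolated_K_method_norm F N0 N1 theta2 q2) ->
  exists2 a, 1 < a & dilation_bounded a.
Proof.
move=> sN0 sN1 N01 rich /andP[th10 th11] th2 th12 q11 q21 [D [D0 HD]].
have /andP[th20 th21] := th2.
pose theta' := (theta1 + theta2) / 2.
have th1' : theta1 < theta' by rewrite /theta'; lra.
have th'2 : theta' < theta2 by rewrite /theta'; lra.
have th'1 := lt_trans th'2 th21.
have b01 : 0 < 1 - theta' < 1 by rewrite subr_gt0 th'1 gtrBl (lt_trans th10).
have /andP[b0 b1] := b01.
have [C C0 HC] := K_functional_interpolation_le th10 th1' th'1 q11.
have [B B0 HB] := rich _ b01.
have N00 x : (0 <= N0 x)%E by have [] := sN0.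
have N10 x : (0 <= N1 x)%E by have [] := sN1.
exists ((1 - theta2)^-1 * (1 - theta')).
  by rewrite mulrC ltr_pdivlMr ?subr_gt0// mul1r ltrD2l ltrN2.
exists (4 * B * (D * (C * B))); first by rewrite !mulr_gt0.
move=> eta qeta etaoo; have [x sx Hx] := HB _ qeta.
pose phi t := fine (K_functional N0 N1 t x).
have le1 t : 0 < t <= 1 -> power_dilation (1 - theta')^-1 phi t <= B * eta t.
  move=> t01; have /andP[t0 t1] := t01.
  have a0 : 0 <= (1 - theta')^-1 by rewrite invr_ge0 ltW.
  have [_ h] := Hx _ (powR_itv01 a0 t01).
  rewrite /power_dilation.
  apply: le_trans (ler_wpM2l (powR_ge0 _ _) h) _.
  have := power_dilation_comp (1 - theta')^-1 (1 - theta') eta t0.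
  rewrite mulVf ?gt_eqF// power_dilation1// => <-.
  by rewrite mulrCA ler_pM2l.
have qB : quasiconcave (fun t => B * eta t).
  by apply: quasiconcave_scale => //; exact: ltW.
have [sX1 psi1] := HC _ _ _ _ _ sN0 sN1 N01 sx qB le1.
have X10 y : (0 <= real_interpolation_norm N0 N1 theta1 q1 y)%E.
  exact: real_interpolation_norm_ge0.
have X20 y : (0 <= real_interpolation_norm N0 N1 theta2 q2 y)%E.
  exact: real_interpolation_norm_ge0.
have F1 : (interpolated_K_method_norm F N0 N1 theta1 q1 x <=
    (C * B)%:E * F eta)%E.
  apply: le_trans (K_method_norm_le X10 N10 sX1 psi1) _.
  rewrite !lattice_norm_scale ?(ltW B0) ?(ltW C0)// EFinM muleA.
  exact: lexx.
have F2 : (interpolated_K_method_norm F N0 N1 theta2 q2 x <=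
    (D * (C * B))%:E * F eta)%E.
  have [_ h] := HD x; apply: le_trans h _; rewrite EFinM -muleA lee_wpmul2l//.
  by rewrite lee_fin ltW.
(* Membership follows from finiteness of the norm, since [K_method_norm] is +oo off the sum
   space. *)
have sX2 : in_sum (real_interpolation_norm N0 N1 theta2 q2) N1 x.
  apply: contrapT => nsX; move: F2.
  rewrite /interpolated_K_method_norm /K_method_norm asboolF// leNgt.
  by rewrite (lattice_norm_fineK etaoo) -EFinM ltry.
(* The majorant is a multiple of a K-functional, hence quasi-concave. *)
exists (fun t => 4 * B * fine (K_functional
  (real_interpolation_norm N0 N1 theta2 q2) N1 t x)); split.
- apply: quasiconcave_scale; first by rewrite mulr_ge0 ?(ltW B0).
  exact: quasiconcave_K_functional.
- move=> t t01; have /andP[t0 t1] := t01.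
  rewrite -power_dilation_comp//.
  have a0 : 0 <= (1 - theta2)^-1 by rewrite invr_ge0 subr_ge0 ltW.
  have [h _] := Hx _ (powR_itv01 a0 t01).
  rewrite {1}/power_dilation.
  apply: le_trans (ler_wpM2l (powR_ge0 _ _) h) _.
  rewrite mulrCA (mulrC 4) -mulrA ler_pM2l//.
  exact: (power_dilation_le_K_functional sN0 sN1 N01 th2 q21 sX2 t0).
- move: F2; rewrite /interpolated_K_method_norm /K_method_norm asboolT// => F2.
  rewrite lattice_norm_scale ?mulr_ge0 ?(ltW B0)//.
  rewrite [X in (_ <= X * _)%E]EFinM -muleA.
  by rewrite lee_wpmul2l// lee_fin mulr_ge0 ?(ltW B0).
Qed.

End dilation_bounded.

(** * The couple of L^1 and L^oo *)

Section restricted_measure.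
Import HBNNSimple.
Local Open Scope ereal_scope.

(* g is not assumed measurable, hence the passage through simple functions. *)
Lemma ge0_integral_mrestr d (T : measurableType d) (R : realType)
    (mu : {measure set T -> \bar R}) (D : set T) (mD : measurable D)
    (g : T -> \bar R) : (forall x, 0 <= g x) ->
  \int[mrestr mu mD]_x g x = \int[mu]_(x in D) g x.
Proof.
move=> g0; pose nu : {measure set T -> \bar R} := mrestr mu mD.
have sE (h : {nnsfun T >-> R}) : sintegral nu h = sintegral mu (h \_ D).
  rewrite !sintegralET; apply: eq_fsbigr => x _.
  (* The value 0 is set apart: h \_ D also takes it off D, so only the other level sets agree. *)
  have [->|x0] := eqVneq x 0%R; first by rewrite !mul0e.
  congr (_ * _); rewrite /nu/= /mrestr; congr (mu _).
  apply/seteqP; split => t /=; rewrite patchE.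
    by move=> [<- Dt]; rewrite mem_set.
  case: ifPn => [/set_mem Dt //|_ x0E].
  by move: x0; rewrite -x0E eqxx.
rewrite -/nu ge0_integralTE// ge0_integralE//; apply/eqP; rewrite eq_le.
apply/andP; split; apply: ereal_sup_le => _ [h /= hg <-].
- exists (proj_nnsfun h mD); last by rewrite sE mrestrict.
  move=> t; have <- : (h \_ D) t = proj_nnsfun h mD t by rewrite mrestrict.
  by rewrite !patchE; case: ifPn.
- exists h.
    by move=> t; apply: le_trans (hg t) _; rewrite patchE; case: ifPn.
  rewrite sE; congr (sintegral _ _); apply/funext => t; rewrite patchE.
  case: ifPn => // tD; have := hg t; rewrite patchE (negbTE tD) lee_fin => ht.
  by apply/le_anti/andP; split => //; exact: fun_ge0.
Qed.

End restricted_measure.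

Section L1_Linfty.
Context {R : realType}.
Implicit Types (f g : R -> R).
Local Notation mu := (@lebesgue_measure R).

Lemma L1_normE f : measurable01 f ->
  (L1_norm f = \int[mu]_(t in `[0%R, 1%R]) `|(f t)%:E|)%E.
Proof.
move=> mf; rewrite /L1_norm /Lp01_norm asboolT// Lnorm1.
exact: ge0_integral_mrestr.
Qed.

Lemma Lp01_norm_ge0 p f : (0 <= Lp01_norm p f)%E.
Proof. by rewrite /Lp01_norm; case: ifP => // _; exact: Lnorm_ge0. Qed.

Lemma Lp01_norm0 p : (1 <= p)%E -> Lp01_norm p (0%R : R -> R) = 0%E.
Proof.
move=> p1; rewrite /Lp01_norm asboolT; last exact: measurable_cst.
rewrite (_ : _ \o _ = cst 0%E)//; apply: Lnorm0.
by rewrite gt_eqF// (lt_le_trans _ p1).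
Qed.

Lemma Lp01_normN p f : Lp01_norm p (- f) = Lp01_norm p f.
Proof.
rewrite /Lp01_norm (_ : `[< measurable01 (- f) >] = `[< measurable01 f >]).
  case: ifP => // _; rewrite -[RHS]oppe_Lnorm; congr (Lnorm _ _ _).
apply/asbool_equiv_eq; split => mf; last exact: measurable_funN.
by rewrite -[f]opprK; exact: measurable_funN.
Qed.

Lemma ext_seminorm_L1 : ext_seminorm (@L1_norm R).
Proof.
split; [exact: Lp01_norm_ge0|exact: Lp01_norm0|exact: Lp01_normN|].
move=> f g; have [mf|nf] := pselect (measurable01 f); last first.
  rewrite {2}/L1_norm Lp01_norm_notin// addye ?leey// gt_eqF//.
  exact: lt_le_trans (Lp01_norm_ge0 _ _).
have [mg|ng] := pselect (measurable01 g); last first.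
  rewrite {3}/L1_norm Lp01_norm_notin// addey ?leey// gt_eqF//.
  exact: lt_le_trans (Lp01_norm_ge0 _ _).
have mfg : measurable01 (f + g) by exact: measurable_funD.
rewrite !L1_normE// -ge0_integralD//; last 2 first.
- by apply: measurableT_comp => //; exact/measurable_EFinP.
- by apply: measurableT_comp => //; exact/measurable_EFinP.
apply: ge0_le_integral => //.
- by apply: measurableT_comp => //; exact/measurable_EFinP.
- by apply: emeasurable_funD => //; apply: measurableT_comp => //;
    exact/measurable_EFinP.
- by move=> t _; rewrite -EFinD lee_fin; exact: ler_normD.
Qed.

Lemma Linfty_norm_ae f : (Linfty_norm f < +oo)%E ->
  measurable01 f /\ \forall t \ae leb01 R, `|f t| <= fine (Linfty_norm f).
Proof.
by move=> foo; apply/Linfty_norm_leP; rewrite -(Linfty_norm_finE foo) lexx.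
Qed.

Lemma ext_seminorm_Linfty : ext_seminorm (@Linfty_norm R).
Proof.
split; [exact: Lp01_norm_ge0|by apply: Lp01_norm0; rewrite leey|exact: Lp01_normN|].
move=> f g; have [foo|] := ltP (Linfty_norm f) +oo%E; last first.
  rewrite leye_eq => /eqP ->; rewrite addye ?leey// gt_eqF//.
  exact: lt_le_trans (Linfty_norm_ge0 _).
have [goo|] := ltP (Linfty_norm g) +oo%E; last first.
  rewrite leye_eq => /eqP ->; rewrite addey ?leey// gt_eqF//.
  exact: lt_le_trans (Linfty_norm_ge0 _).
have fE := Linfty_norm_finE foo; have gE := Linfty_norm_finE goo.
have [mf af] := Linfty_norm_ae foo.
have [mg ag] := Linfty_norm_ae goo.
rewrite fE gE -EFinD; apply/Linfty_norm_leP; split; first exact: measurable_funD.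
apply: ae_leb01S (ae_leb01I af ag) => t _ [ft gt].
by apply: le_trans (ler_normD _ _) _; exact: lerD.
Qed.

Lemma L1_norm_le_Linfty f : (L1_norm f <= Linfty_norm f)%E.
Proof.
have [foo|] := ltP (Linfty_norm f) +oo%E; last first.
  by rewrite leye_eq => /eqP ->; rewrite leey.
have fE := Linfty_norm_finE foo.
have [mf af] := Linfty_norm_ae foo.
rewrite L1_normE// fE.
have -> : (fine (Linfty_norm f))%:E = (\int[mu]_(t in `[0%R, 1%R])
    cst (fine (Linfty_norm f))%:E t)%E.
  by rewrite integral_cst//= lebesgue_measure_itv/= lte_fin ltr01 oppr0 adde0 mule1.
apply: ae_ge0_le_integral => //.
- by apply: measurableT_comp => //; exact/measurable_EFinP.
- by move=> t _; rewrite lee_fin fine_ge0// Linfty_norm_ge0.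
- have /ae_leb01P[A [mA A0 nA]] := af.
  exists (A `|` [set 0]); split; first exact: measurableU.
    apply/eqP; rewrite -measure_le0; apply: (@le_trans _ _ (mu A + mu [set 0%R])%E).
      exact: measureU2.
    by rewrite A0 lebesgue_measure_set1 adde0.
  move=> t /= /not_implyP[/=]; rewrite in_itv/= => /andP[t0 t1] nt.
  have [->|t00] := eqVneq t 0; first by right.
  by left; apply: nA; split => //=; rewrite lt_neqAle eq_sym t00 t0.
Qed.

End L1_Linfty.

Section L1_Linfty_K_functional.
Context {R : realType}.
Implicit Types (f g eta : R -> R).
Local Notation mu := (@lebesgue_measure R).
Local Notation K := (K_functional (@L1_norm R) (@Linfty_norm R)).

(* If t^-1 phi(t) decreases and its integral over (0, t] is comparable with
   phi(t), then phi is equivalent to the K-functional of t^-1 phi(t); the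
   integral is comparable here because eta increases and b < 1. *)
Lemma L1_Linfty_power_dilation b : 0 < b < 1 -> exists2 C : R, 0 < C &
  forall eta, quasiconcave eta -> exists2 f,
    in_sum (@L1_norm R) (@Linfty_norm R) f &
    forall t, 0 < t <= 1 ->
      power_dilation b eta t <= C * fine (K t f) /\
      fine (K t f) <= C * power_dilation b eta t.
Proof.
move=> /andP[b0 b1]; have b'0 : 0 < 1 - b by rewrite subr_gt0.
(* The first term bounds the integral of f over (0, t], the second comes from t f(t) = phi t, the
   cost of the part beyond t. *)
pose C := (1 - b)^-1 + 1.
have C1 : 1 <= C by rewrite lerDr invr_ge0 ltW.
exists C; first exact: lt_le_trans C1.
move=> eta qeta; pose phi := power_dilation b eta.
have b01 : 0 <= b <= 1 by rewrite !ltW.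
have qphi : quasiconcave phi by exact: quasiconcave_power_dilation.
pose f s := phi s / s.
have mf : measurable01 f.
  apply: measurable_funM; first exact: quasiconcave_measurable.
  by apply: measurable_fun_invr => //; apply: subset_itvl; rewrite bnd_simp.
have phi0 s : 0 < s <= 1 -> 0 <= phi s by exact: quasiconcave_ge0.
have f0 s : 0 < s <= 1 -> 0 <= f s.
  by move=> s01; have /andP[s0 _] := s01; rewrite divr_ge0 ?(ltW s0)// phi0.
have fd s t : 0 < s -> s <= t -> t <= 1 -> f t <= f s.
  move=> s0 st t1; have t0 := lt_le_trans s0 st.
  have [_ _ h] := qphi s t s0 st t1.
  by rewrite /f ler_pdivrMr// mulrAC ler_pdivlMr// mulrC [leRHS]mulrC.
have fle s t : 0 < s -> s <= t -> t <= 1 -> f s <= s `^ (- b) * eta (t `^ b).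
  move=> s0 st t1; have t0 := lt_le_trans s0 st.
  have -> : f s = s `^ (- b) * eta (s `^ b).
    rewrite /f /phi power_dilationE// powRN; field.
    by rewrite !gt_eqF// powR_gt0.
  rewrite ler_wpM2l ?invr_ge0 ?powR_ge0//.
  have s01 : 0 < s <= 1 by rewrite s0 (le_trans st).
  have t01 : 0 < t <= 1 by rewrite t0.
  have /andP[sb0 sb1] := powR_itv01 (ltW b0) s01.
  have /andP[tb0 tb1] := powR_itv01 (ltW b0) t01.
  have sbt : s `^ b <= t `^ b.
    by apply: ge0_ler_powR => //; rewrite ?nnegrE ltW.
  by have [] := qeta _ _ sb0 sbt tb1.
have sub01 t : t <= 1 -> (`]0, t]%classic : set R) `<=` `[0, 1]%classic.
  by move=> t1; apply: subset_itv; rewrite bnd_simp.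
have mft t : t <= 1 -> measurable_fun (`]0, t]%classic : set R) f.
  by move=> t1; apply: measurable_funS mf => //; exact: sub01.
have intf t : 0 < t <= 1 ->
    (\int[mu]_(s in `]0%R, t]) `|(f s)%:E| <= ((1 - b)^-1 * phi t)%:E)%E.
  move=> t01; have /andP[t0 t1] := t01.
  have e0 : 0 <= eta (t `^ b).
    by apply: (quasiconcave_ge0 qeta); exact: powR_itv01 (ltW b0) t01.
  apply: (@le_trans _ _ (\int[mu]_(s in `]0%R, t])
      ((eta (t `^ b))%:E * (s `^ (1 - b - 1))%:E))%E).
    apply: ge0_le_integral => //.
    - by apply: measurableT_comp => //; apply/measurable_EFinP; exact: mft.
    - apply/measurable_EFinP; apply: measurable_funM => //.
      apply: measurable_funTS; exact: measurable_powR.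
    - move=> s /=; rewrite in_itv/= => /andP[s0 st].
      rewrite lee_fin ger0_norm; last by rewrite f0// s0 (le_trans st).
      by rewrite mulrC addrAC subrr add0r; exact: fle.
  rewrite ge0_integralZl//; last 2 first.
  - apply/measurable_EFinP; apply: measurable_funTS; exact: measurable_powR.
  - by move=> s _; rewrite lee_fin powR_ge0.
  apply: le_trans (lee_wpmul2l _ (integral_powR_0b_le b'0 t0)) _.
    by rewrite lee_fin.
  by rewrite -EFinM lee_fin /phi /power_dilation mulrC mulrAC mulrC.
have split_f t : 0 < t <= 1 -> exists a0 a1, [/\ (L1_norm a0 < +oo)%E,
    (Linfty_norm a1 < +oo)%E, f = a0 + a1 &
    (L1_norm a0 + t%:E * Linfty_norm a1 <= (C * phi t)%:E)%E].
  move=> t01; have /andP[t0 t1] := t01.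
  pose a0 := f \_ `]0, t]%classic; pose a1 := f - a0.
  have ma0 : measurable01 a0.
    apply/(measurable_restrict _ _ _) => //.
    by rewrite (setIidr (sub01 _ t1)); exact: mft.
  have La0 : (L1_norm a0 <= ((1 - b)^-1 * phi t)%:E)%E.
    rewrite L1_normE//; apply: le_trans (intf _ t01).
    rewrite -(setIidr (sub01 _ t1)) integral_mkcondr.
    rewrite le_eqVlt; apply/orP; left; apply/eqP; apply: eq_integral => s _.
    by rewrite /a0 !patchE; case: ifPn => // _; rewrite /= normr0.
  have La1 : (Linfty_norm a1 <= (phi t / t)%:E)%E.
    apply/Linfty_norm_leP; split; first exact: measurable_funB mf ma0.
    apply: ae_leb01 => s s01; have /andP[s0 s1] := s01.
    have -> : a1 s = f s - a0 s by [].
    rewrite /a0 patchE; case: ifPn => [_|].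
      by rewrite subrr normr0; exact: f0.
    rewrite notin_setE/= in_itv/= s0/= => /negP; rewrite -ltNge => ts.
    by rewrite subr0 ger0_norm ?f0// fd// ltW.
  exists a0, a1; split.
  - exact: le_lt_trans La0 (ltry _).
  - exact: le_lt_trans La1 (ltry _).
  - by rewrite /a1 addrC subrK.
  apply: le_trans (leeD La0 (lee_wpmul2l _ La1)) _; first by rewrite lee_fin ltW.
  by rewrite -EFinM -EFinD lee_fin [t * _]mulrC divfK ?gt_eqF// mulrDl mul1r.
have sf : in_sum (@L1_norm R) (@Linfty_norm R) f.
  have [|a0 [a1 [n0 n1 fE _]]] := split_f 1; first by rewrite ltr01 lexx.
  by exists a0, a1.
exists f => // t t01; have /andP[t0 t1] := t01.
have Kfin : K t f \is a fin_num.
  apply: K_functional_fin_num => //; last exact: ltW.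
  - exact: Lp01_norm_ge0.
  - exact: Lp01_norm_ge0.
split; last first.
  have [a0 [a1 [n0 n1 fE le]]] := split_f _ t01.
  rewrite -lee_fin fineK//; apply: le_trans le.
  exact: K_functional_le.
rewrite -/(phi t); apply: (@le_trans _ _ (fine (K t f))); last first.
  rewrite -[leLHS]mul1r ler_wpM2r// fine_ge0// K_functional_ge0// ?ltW//.
  - by move=> y; exact: Lp01_norm_ge0.
  - by move=> y; exact: Lp01_norm_ge0.
rewrite -lee_fin fineK//; apply: le_ereal_inf_tmp => _ [a0 [a1 [n0 n1 fE ->]]].
have ma0 : measurable01 a0.
  apply: contrapT => /Lp01_norm_notin-/(_ 1%E).
  by move: n0; rewrite /L1_norm => /[swap] ->.
have [ma1 aa1] := Linfty_norm_ae n1.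
rewrite (Linfty_norm_finE n1) -EFinM; set M := fine (Linfty_norm a1) in aa1 *.
have M0 : 0 <= M by rewrite fine_ge0// Linfty_norm_ge0.
(* If M >= f t, the term t M suffices. Otherwise |a0| >= f - M >= f t - M a.e. on (0, t], and
   integration gives t (f t - M). *)
have [le|lt] := leP (f t) M.
  apply: (@le_trans _ _ (t * M)%:E).
    by rewrite lee_fin mulrC -ler_pdivrMr.
  by rewrite leeDr// Lp01_norm_ge0.
suff : ((t * (f t - M))%:E <= L1_norm a0)%E.
  move=> h; apply: le_trans (leeD h (lexx _)).
  by rewrite -EFinD lee_fin mulrBr subrK /f mulrC divfK ?gt_eqF.
rewrite L1_normE//.
apply: (@le_trans _ _ (\int[mu]_(s in `]0%R, t]) `|(a0 s)%:E|)%E); last first.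
  apply: ge0_subset_integral => //; last exact: sub01.
  by apply: measurableT_comp => //; exact/measurable_EFinP.
have -> : ((t * (f t - M))%:E = \int[mu]_(s in `]0%R, t]) cst (f t - M)%:E s)%E.
  rewrite integral_cst//= lebesgue_measure_itv/= lte_fin t0 oppr0 adde0.
  by rewrite -EFinM mulrC.
apply: ae_ge0_le_integral => //.
- by move=> s _; rewrite lee_fin subr_ge0 ltW.
- apply: measurableT_comp => //; apply/measurable_EFinP.
  exact: measurable_funS (sub01 _ t1) ma0.
have /ae_leb01P[A [mA A0 nA]] := aa1; exists A; split => // s /= /not_implyP[/=].
rewrite in_itv/= => /andP[s0 st] nle; apply: nA; split => /=.
  by rewrite s0 (le_trans st).
move=> a1M; apply: nle; rewrite lee_fin lerBlDr.
apply: le_trans (fd _ _ s0 st t1) _; rewrite fE.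
apply: le_trans (ler_norm _) _; apply: le_trans (ler_normD _ _) _.
by rewrite lerD2l.
Qed.

End L1_Linfty_K_functional.

(** * The pair of bounded functions with a weight *)

Section bounded_functions.
Context (T : Type) (R : realType).

Definition is_bounded_function : {pred (T -> R^o)} :=
  [pred f : T -> R^o | `[< exists M : R, forall t, `|f t| <= M >]].

Lemma is_bounded_functionP (f : T -> R^o) :
  reflect (exists M : R, forall t, `|f t| <= M) (f \in is_bounded_function).
Proof. exact: asboolP. Qed.

Lemma is_bounded_function_submod : submod_closed is_bounded_function.
Proof.
split; first by apply/is_bounded_functionP; exists 0 => t; rewrite normr0.
move=> a f g /is_bounded_functionP[M fM] /is_bounded_functionP[N gN].
apply/is_bounded_functionP; exists (`|a| * M + N) => t.
apply: le_trans (ler_normD _ _) _; apply: lerD; last exact: gN.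
by rewrite /= normrM ler_wpM2l.
Qed.

HB.instance Definition _ := GRing.isSubmodClosed.Build R (T -> R^o)
  is_bounded_function is_bounded_function_submod.

Record bounded_function := BoundedFunction {
  bounded_function_val :> T -> R^o ;
  _ : bounded_function_val \in is_bounded_function
}.

HB.instance Definition _ := [isSub for bounded_function_val].
HB.instance Definition _ := [Choice of bounded_function by <:].
HB.instance Definition _ := [SubChoice_isSubLmodule of bounded_function by <:].

(** Adjoining 0 keeps the set nonempty even when T is empty. *)
Definition sup_norm (f : bounded_function) : R :=
  sup (0 |` [set `|f t| | t in [set: T]]).

Lemma sup_norm_has_sup (f : bounded_function) :
  has_sup (0 |` [set `|f t| | t in [set: T]]).
Proof.
split; first by exists 0; left.
have /is_bounded_functionP[M fM] := valP f.
exists (Num.max 0 M) => _ [->|[t _ <-]]; first by rewrite le_max lexx.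
by rewrite le_max fM orbT.
Qed.

Lemma le_sup_norm (f : bounded_function) t : `|f t| <= sup_norm f.
Proof. by apply: ub_le_sup; [case: (sup_norm_has_sup f)|right; exists t]. Qed.

Lemma sup_norm_le (f : bounded_function) (M : R) : 0 <= M ->
  (forall t, `|f t| <= M) -> sup_norm f <= M.
Proof.
move=> M0 fM; apply: ge_sup; first by case: (sup_norm_has_sup f).
by move=> _ [->//|[t _ <-]].
Qed.

Lemma sup_norm_ge0 (f : bounded_function) : 0 <= sup_norm f.
Proof. by apply: ub_le_sup; [case: (sup_norm_has_sup f)|left]. Qed.

Lemma sup_normD f g : sup_norm (f + g) <= sup_norm f + sup_norm g.
Proof.
apply: sup_norm_le; first by rewrite addr_ge0// sup_norm_ge0.
by move=> t; apply: le_trans (ler_normD _ _) _; apply: lerD; exact: le_sup_norm.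
Qed.

Lemma sup_normZ (a : R) f : sup_norm (a *: f) = `|a| * sup_norm f.
Proof.
have le (b : R) g : sup_norm (b *: g) <= `|b| * sup_norm g.
  apply: sup_norm_le; first by rewrite mulr_ge0// sup_norm_ge0.
  by move=> t; rewrite /= normrM ler_wpM2l// le_sup_norm.
apply/le_anti; rewrite le/=; have [->|a0] := eqVneq a 0.
  by rewrite normr0 mul0r sup_norm_ge0.
have := le a^-1 (a *: f); rewrite scalerA mulVf// scale1r normfV.
by rewrite ler_pdivlMl ?normr_gt0.
Qed.

Lemma sup_norm_eq0 f : sup_norm f = 0 -> f = 0.
Proof.
move=> f0; apply/val_inj/funext => t; apply/eqP.
by rewrite -normr_le0 -f0 le_sup_norm.
Qed.

HB.instance Definition _ := @Lmodule_isNormed.Build R bounded_function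
  sup_norm sup_normD sup_normZ sup_norm_eq0.

Lemma bounded_function_complete (F : set_system bounded_function) :
  ProperFilter F -> cauchy F -> cvg F.
Proof.
move=> FF /cauchyP F_cauchy.
have ball_le (f f0 : bounded_function) (e : R) t :
    ball f0 e f -> `|f0 t - f t| <= e.
  rewrite -ball_normE/= => /ltW; apply: le_trans; exact: (le_sup_norm (f0 - f)).
have cvF t : cvg ((fun f : bounded_function => (f t : R)) @ F).
  apply: cauchy_cvg; apply: cauchy_exP => e e0.
  have [f0 Ff0] := F_cauchy _ (divr_gt0 e0 (ltr0Sn R 1)); exists (f0 t : R).
  have : F [set f | ball (f0 t : R) e (f t : R)]; last by [].
  apply: filterS Ff0 => f ff0; rewrite /= -ball_normE/=.
  apply: le_lt_trans (ball_le _ _ _ t ff0) _.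
  by rewrite ltr_pdivrMr// ltr_pMr// ltr1n.
pose g t : R := lim ((fun f : bounded_function => (f t : R)) @ F).
(* The bound passes to the pointwise limit with the same e for all t; this uniformity upgrades
   pointwise to norm convergence. *)
have g_le (f0 : bounded_function) (e : R) t : F (ball f0 e) -> `|g t - f0 t| <= e.
  move=> Ff0; apply/ler_addgt0Pr => d d0.
  have /cvgrPdist_le/(_ d d0) gd := cvF t.
  have [f [fd f0f]] := filter_ex (filterI gd Ff0).
  rewrite -(subrKA (f t : R)) (addrC e); apply: le_trans (ler_normD _ _) _.
  by apply: lerD => //; rewrite distrC; exact: ball_le.
have gb : (g : T -> R^o) \in is_bounded_function.
  have [f0 Ff0] := F_cauchy 1 ltr01.
  have /is_bounded_functionP[M fM] := valP f0.
  apply/is_bounded_functionP; exists (1 + M) => t.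
  rewrite -(subrK (f0 t : R) (g t)); apply: le_trans (ler_normD _ _) _.
  by apply: lerD; [exact: g_le|exact: fM].
apply/cvg_ex; exists (BoundedFunction gb); apply/cvgrPdist_le => /= e e0.
have [f0 Ff0] := F_cauchy _ (divr_gt0 e0 (ltr0Sn R 1)).
have gf0 t := g_le _ _ t Ff0.
apply: filterS Ff0 => f ff0; apply: sup_norm_le; first exact: ltW.
move=> t; rewrite (splitr e).
have -> : (BoundedFunction gb - f) t = (g t - f0 t) + (f0 t - f t).
  by rewrite addrA subrK.
by apply: le_trans (ler_normD _ _) _; apply: lerD; [exact: gf0|exact: ball_le].
Qed.

HB.instance Definition _ := Uniform_isComplete.Build bounded_function
  bounded_function_complete.

End bounded_functions.

(** * Norms of embedded spaces as extended seminorms *)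

Section embedded_norms.
Context {R : realType}.

Lemma embedded_normE (B : normedModType R) (V : Type) (j : B -> V) (a : B) :
  injective j -> embedded_norm j (j a) = (`|a|)%:E.
Proof.
move=> ij; rewrite /embedded_norm (_ : _ @` _ = [set (`|a|)%:E]) ?ereal_inf1//.
apply/seteqP; split => [_ [b /= /ij -> <-]//|_ ->]; by exists a.
Qed.

Lemma embedded_norm_notin (B : normedModType R) (V : Type) (j : B -> V) (x : V) :
  ~ (exists a, j a = x) -> embedded_norm j x = +oo%E.
Proof.
move=> nx; rewrite /embedded_norm (_ : _ @` _ = set0) ?ereal_inf0//.
by apply/seteqP; split => // _ [a /= ax _]; apply: nx; exists a.
Qed.

Lemma ext_seminorm_embedded (B : normedModType R) (V : lmodType R)
  (j : {linear B -> V}) : injective j -> ext_seminorm (embedded_norm j).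
Proof.
move=> ij.
have ge0 x : (0 <= embedded_norm j x)%E.
  by apply: le_ereal_inf_tmp => _ [a _ <-]; rewrite lee_fin.
split => //.
- by rewrite -(linear0 j) embedded_normE// normr0.
- move=> x; have [[a <-]|nx] := pselect (exists a, j a = x).
    by rewrite -linearN !embedded_normE// normrN.
  rewrite (embedded_norm_notin nx) embedded_norm_notin// => -[a ax].
  by apply: nx; exists (- a); rewrite linearN ax opprK.
- move=> x y; have [[a <-]|nx] := pselect (exists a, j a = x); last first.
    rewrite (embedded_norm_notin nx) addye ?leey// gt_eqF//.
    exact: lt_le_trans (ge0 _).
  have [[b <-]|ny] := pselect (exists b, j b = y); last first.
    rewrite (embedded_norm_notin ny) addey ?leey// gt_eqF//.
    exact: lt_le_trans (ge0 _).
  by rewrite -linearD !embedded_normE// -EFinD lee_fin; exact: ler_normD.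
Qed.

Lemma pair_norm_le (A : banach_pair R) : ordered_pair A ->
  forall x, (pair_norm0 A x <= pair_norm1 A x)%E.
Proof.
move=> oA x; have [[a1 <-]|nx] := pselect (exists a, pair_emb1 A a = x); last first.
  by rewrite /pair_norm1 embedded_norm_notin// leey.
have [a0 a01 le] := oA a1.
rewrite /pair_norm1 embedded_normE; last exact: pair_inj1.
by rewrite -a01 /pair_norm0 embedded_normE ?lee_fin//; exact: pair_inj0.
Qed.

End embedded_norms.

Lemma linear_contraction_continuous (R : realType) (V W : normedModType R)
  (f : {linear V -> W}) : (forall x, `|f x| <= `|x|) -> continuous f.
Proof.
move=> fle x; apply/cvgrPdist_lt => e e0.
have : nbhs x (ball x e) by exact: nbhsx_ballx.
apply: filterS => y; rewrite -ball_normE/= => xy.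
by rewrite -linearB; apply: le_lt_trans (fle _) _.
Qed.

(* The second space is the first one embedded by multiplication by weight01:
   inside the ambient space it consists of the f with f / weight01 bounded. *)
Section weighted_pair.
Context {R : realType}.
Local Notation B := (bounded_function R R).
Implicit Types (f : B) (s t : R).

(** The value 1 off (0, 1] keeps multiplication by the weight injective and contractive on functions
    defined on all of R. *)
Definition weight01 s : R := if 0 < s <= 1 then s else 1.

Lemma weight01_gt0 s : 0 < weight01 s.
Proof. by rewrite /weight01; case: ifP => // /andP[]. Qed.

Lemma weight01_le1 s : weight01 s <= 1.
Proof. by rewrite /weight01; case: ifP => // /andP[]. Qed.

Lemma weighted_subproof f :
  (fun s => weight01 s * f s : R^o) \in @is_bounded_function R R.
Proof.
have /is_bounded_functionP[M fM] := valP f.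
apply/is_bounded_functionP; exists M => s; apply: le_trans (fM s).
by rewrite normrM gtr0_norm ?weight01_gt0// ler_piMl// weight01_le1.
Qed.

Definition weighted f : B := BoundedFunction (weighted_subproof f).

Lemma weighted_linear : linear weighted.
Proof.
move=> a f g; apply/val_inj/funext => s.
by rewrite /= /GRing.add/= /GRing.scale/= mulrDr mulrCA.
Qed.

HB.instance Definition _ := GRing.isLinear.Build R B B _ weighted weighted_linear.

Lemma weighted_inj : injective weighted.
Proof.
move=> f g fg; apply/val_inj/funext => s.
have /(congr1 (fun h : B => h s)) /= := fg.
by apply: mulfI; rewrite gt_eqF// weight01_gt0.
Qed.

Lemma norm_weighted f : `|weighted f| <= `|f|.
Proof.
apply: sup_norm_le; first exact: sup_norm_ge0.
move=> s; rewrite /= normrM gtr0_norm ?weight01_gt0//.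
apply: le_trans (le_sup_norm f s).
by rewrite ler_piMl// weight01_le1.
Qed.

Lemma weighted_continuous : continuous weighted.
Proof. exact: linear_contraction_continuous norm_weighted. Qed.

Definition weighted_pair : banach_pair R :=
  @BanachPair R B (@norm_hausdorff _ _) B B idfun weighted
    (fun _ _ => id) weighted_inj (fun x => @cvg_id _ _) weighted_continuous.

Lemma ordered_weighted_pair : ordered_pair weighted_pair.
Proof. by move=> f; exists (weighted f) => //; exact: norm_weighted. Qed.

(* K(t, f) is the supremum of min(1, t / s) |f s| up to a factor 2. *)
Lemma weighted_pair_K_functional (phi : R -> R) : quasiconcave phi ->
  exists2 f, in_sum (pair_norm0 weighted_pair) (pair_norm1 weighted_pair) f &
    forall t, 0 < t <= 1 ->
      phi t <= 2 * fine (K_functional (pair_norm0 weighted_pair)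
                          (pair_norm1 weighted_pair) t f) /\
      fine (K_functional (pair_norm0 weighted_pair)
              (pair_norm1 weighted_pair) t f) <= 2 * phi t.
Proof.
move=> qphi.
have phi0 s : 0 < s <= 1 -> 0 <= phi s by exact: quasiconcave_ge0.
have bnd (h : R -> R) M : (forall s, `|h s| <= M) ->
    (h : R -> R^o) \in @is_bounded_function R R.
  by move=> hM; apply/is_bounded_functionP; exists M.
pose x0 s := if 0 < s <= 1 then phi s else 0.
have x0b s : `|x0 s| <= phi 1.
  rewrite /x0; case: ifPn => [/[dup] s01 /andP[s0 s1]|_].
    by rewrite ger0_norm ?phi0//; have [] := qphi s 1 s0 s1 (lexx 1).
  by rewrite normr0 phi0// ltr01 lexx.
pose x : B := BoundedFunction (bnd _ _ x0b).
have N0E (f : B) : pair_norm0 weighted_pair f = (`|f|)%:E.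
  exact: (@embedded_normE _ B B idfun f (fun _ _ => id)).
have N1E (f : B) : pair_norm1 weighted_pair (weighted f) = (`|f|)%:E.
  exact: (@embedded_normE _ B B weighted f weighted_inj).
have N00 (f : B) : (0 <= pair_norm0 weighted_pair f)%E by rewrite N0E lee_fin.
have N10 (f : B) : (0 <= pair_norm1 weighted_pair f)%E.
  have [ge0 _ _ _] := @ext_seminorm_embedded _ _ _ weighted weighted_inj.
  exact: ge0.
have sx : in_sum (pair_norm0 weighted_pair) (pair_norm1 weighted_pair) x.
  exists x, (weighted 0); split; [by rewrite N0E ltry|by rewrite N1E ltry|].
  by rewrite linear0 addr0.
exists x => // t t01; have /andP[t0 t1] := t01.
have Kfin := K_functional_fin_num N00 N10 (ltW t0) sx.
have pt0 := phi0 _ t01.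
split.
  apply: (@le_trans _ _ (1 * fine (K_functional (pair_norm0 weighted_pair)
                          (pair_norm1 weighted_pair) t x))); last first.
    by rewrite ler_wpM2r ?ler1n// fine_ge0// K_functional_ge0// ltW.
  rewrite mul1r -lee_fin fineK//.
  apply: le_ereal_inf_tmp => _ [a0 [a1 [n0 n1 xE ->]]].
  have [[b ba]|nb] := pselect (exists b, weighted b = a1); last first.
    by move: n1; rewrite /pair_norm1 embedded_norm_notin.
  rewrite -ba N0E N1E -EFinM -EFinD lee_fin.
  (* Every decomposition is tested at the single point t, where the weight equals t. *)
  have : x t = a0 t + weight01 t * b t by rewrite xE -ba.
  rewrite /= /x0 /weight01 t01 => ->; apply: le_trans (ler_norm _) _.
  apply: le_trans (ler_normD _ _) _; apply: lerD; first exact: le_sup_norm.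
  by rewrite normrM (gtr0_norm t0) ler_pM2l// le_sup_norm.
(* x is cut at t. Monotonicity of phi bounds the part up to t by phi t; the decrease of phi s / s
   bounds the rest, divided by the weight, by phi t / t. *)
pose y0 s := if s <= t then x0 s else 0.
have y0b s : `|y0 s| <= phi t.
  rewrite /y0 /x0; case: ifPn => [st|_]; last by rewrite normr0.
  case: ifPn => [/[dup] s01 /andP[s0 s1]|_]; last by rewrite normr0.
  by rewrite ger0_norm ?phi0//; have [] := qphi s t s0 st t1.
pose z0 s := if s <= t then 0 else x0 s / weight01 s.
have z0b s : `|z0 s| <= phi t / t.
  rewrite /z0 /x0 /weight01; case: ifPn => [st|].
    by rewrite normr0 divr_ge0// ltW.
  rewrite -ltNge => ts; case: ifPn => [/[dup] s01 /andP[s0 s1]|_]; last first.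
    by rewrite mul0r normr0 divr_ge0// ltW.
  rewrite ger0_norm; last by rewrite divr_ge0 ?phi0// ltW.
  have [_ _ h] := qphi t s t0 (ltW ts) s1.
  by rewrite ler_pdivrMr// mulrAC ler_pdivlMr// mulrC [leRHS]mulrC.
pose y : B := BoundedFunction (bnd _ _ y0b).
pose z : B := BoundedFunction (bnd _ _ z0b).
have xE : x = y + weighted z.
  apply/val_inj/funext => s; rewrite /= /GRing.add/= /y0 /z0.
  case: ifPn => _; first by rewrite mulr0 addr0.
  by rewrite add0r mulrC divfK// gt_eqF// weight01_gt0.
rewrite -lee_fin fineK//.
apply: le_trans (K_functional_le t _ _ xE) _;
  [by rewrite N0E ltry|by rewrite N1E ltry|].
rewrite N0E N1E -EFinM -EFinD lee_fin.
have yn : `|y| <= phi t by exact: sup_norm_le.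
have zn : `|z| <= phi t / t by apply: sup_norm_le => //; rewrite divr_ge0// ltW.
apply: (@le_trans _ _ (phi t + t * (phi t / t))).
  by apply: lerD => //; rewrite ler_pM2l.
by rewrite [t * _]mulrC divfK ?gt_eqF//; lra.
Qed.

End weighted_pair.

(** * Passing between the four conditions *)

Section equivalences.
Context {R : realType}.

Lemma norm_equiv_with_trans (V : Type) (C D : R) (N M N' : V -> \bar R) :
  norm_equiv_with C N M -> norm_equiv_with D N' M -> norm_equiv N N'.
Proof.
move=> [C0 NM] [D0 NM']; exists (C * D); split=> [|x]; first exact: mulr_gt0.
have [h1 h2] := NM x; have [h3 h4] := NM' x; split.
- by apply: le_trans h1 _; rewrite EFinM -muleA lee_wpmul2l// lee_fin ltW.
- apply: le_trans h3 _; rewrite mulrC EFinM -muleA lee_wpmul2l// lee_fin.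
  exact: ltW.
Qed.

Lemma norm_equiv_sym (V : Type) (N N' : V -> \bar R) :
  norm_equiv N N' -> norm_equiv N' N.
Proof. by move=> [C [C0 h]]; exists C; split => // x; have [] := h x. Qed.

Variable F : banach_lattice01 R.
Hypothesis hF : interpolation_lattice F.

Lemma dilation_bounded_of_exists_equiv (V : zmodType) (N0 N1 : V -> \bar R) :
  ext_seminorm N0 -> ext_seminorm N1 -> (forall x, (N0 x <= N1 x)%E) ->
  (forall b, 0 < b < 1 -> exists2 C : R, 0 < C & forall eta, quasiconcave eta ->
    exists2 x, in_sum N0 N1 x & forall t, 0 < t <= 1 ->
      power_dilation b eta t <= C * fine (K_functional N0 N1 t x) /\
      fine (K_functional N0 N1 t x) <= C * power_dilation b eta t) ->
  (exists (theta1 theta2 : R) (q1 q2 : \bar R),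
    [/\ 0 < theta1 < 1, 0 < theta2 < 1, theta1 <> theta2,
        (1 <= q1)%E /\ (1 <= q2)%E &
      norm_equiv (interpolated_K_method_norm F N0 N1 theta1 q1)
        (interpolated_K_method_norm F N0 N1 theta2 q2)]) ->
  forall a, 0 <= a -> dilation_bounded F a.
Proof.
move=> sN0 sN1 N01 rich [theta1 [theta2 [q1 [q2 [th1 th2 th12 [q11 q21] eqv]]]]].
have [a a1 ba] : exists2 a, 1 < a & dilation_bounded F a.
  have [lt|lt|//] := ltgtP theta1 theta2.
  - exact: (dilation_bounded_of_equiv sN0 sN1 N01 rich th1 th2 lt q11 q21 eqv).
  - exact: (dilation_bounded_of_equiv sN0 sN1 N01 rich th2 th1 lt q21 q11
      (norm_equiv_sym eqv)).
by move=> b; exact: dilation_bounded_all ba.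
Qed.

Lemma exists_interpolated_equiv (V : zmodType) (N0 N1 : V -> \bar R) :
  (forall theta q, 0 < theta < 1 -> (1 <= q)%E -> exists C : R,
    norm_equiv_with C (interpolated_K_method_norm F N0 N1 theta q)
      (K_method_norm F N0 N1)) ->
  exists (theta1 theta2 : R) (q1 q2 : \bar R),
    [/\ 0 < theta1 < 1, 0 < theta2 < 1, theta1 <> theta2,
        (1 <= q1)%E /\ (1 <= q2)%E &
      norm_equiv (interpolated_K_method_norm F N0 N1 theta1 q1)
        (interpolated_K_method_norm F N0 N1 theta2 q2)].
Proof.
move=> eqv; have th1 : 0 < (1 / 3 : R) < 1 by lra.
have th2 : 0 < (2 / 3 : R) < 1 by lra.
(* Any two exponents would do, both norms being equivalent to that of the original pair. *)
exists (1 / 3), (2 / 3), 1%E, 1%E; split => //; first lra.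
have [C hC] := eqv _ 1%E th1 (lexx _); have [D hD] := eqv _ 1%E th2 (lexx _).
exact: norm_equiv_with_trans hC hD.
Qed.

End equivalences.

Theorem theorem5 (R : realType) (F : banach_lattice01 R)
    (hF : interpolation_lattice F) :
  [<->
    (* (i) *)
    bounded_on F square_operator;
    (* (ii) *)
    forall (theta : R) (q : \bar R), 0 < theta < 1 -> (1 <= q)%E ->
      exists C : R, forall A : banach_pair R, ordered_pair A ->
        norm_equiv_with C
          (interpolated_K_method_norm F (pair_norm0 A) (pair_norm1 A) theta q)
          (K_method_norm F (pair_norm0 A) (pair_norm1 A));
    (* (iii) *)
    forall A : banach_pair R, ordered_pair A ->
      exists (theta1 theta2 : R) (q1 q2 : \bar R),
        [/\ 0 < theta1 < 1, 0 < theta2 < 1, theta1 <> theta2,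
            (1 <= q1)%E /\ (1 <= q2)%E &
          norm_equiv
            (interpolated_K_method_norm F (pair_norm0 A) (pair_norm1 A) theta1 q1)
            (interpolated_K_method_norm F (pair_norm0 A) (pair_norm1 A) theta2 q2)];
    (* (iv) *)
    exists (theta1 theta2 : R) (q1 q2 : \bar R),
      [/\ 0 < theta1 < 1, 0 < theta2 < 1, theta1 <> theta2,
          (1 <= q1)%E /\ (1 <= q2)%E &
        norm_equiv
          (interpolated_K_method_norm F L1_norm Linfty_norm theta1 q1)
          (interpolated_K_method_norm F L1_norm Linfty_norm theta2 q2)]].
Proof.
have sL1 := @ext_seminorm_L1 R; have sLoo := @ext_seminorm_Linfty R.
have s0 (A : banach_pair R) : ext_seminorm (pair_norm0 A).
  by apply: ext_seminorm_embedded; exact: pair_inj0.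
have s1 (A : banach_pair R) : ext_seminorm (pair_norm1 A).
  by apply: ext_seminorm_embedded; exact: pair_inj1.
tfae.
- move=> sq theta q th q1.
  have ball := @dilation_bounded_all _ F _ _ (ltr1n _ 2) (dilation_bounded2 hF sq).
  have [C HC] := interpolated_K_method_norm_equiv ball th q1.
  by exists C => A oA; apply: HC => //; exact: pair_norm_le.
- move=> eqv A oA; apply: exists_interpolated_equiv => theta q th q1.
  by have [C HC] := eqv _ _ th q1; exists C; exact: HC.
- move=> /(_ _ (@ordered_weighted_pair R)) eqv.
  have ball : forall a, 0 <= a -> dilation_bounded F a.
    apply: dilation_bounded_of_exists_equiv eqv => //.
      by apply: pair_norm_le; exact: ordered_weighted_pair.
    move=> b /andP[b0 b1]; exists 2 => // eta qeta.
    apply: weighted_pair_K_functional; apply: quasiconcave_power_dilation => //.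
    by rewrite !ltW.
  apply: exists_interpolated_equiv => theta q th q1.
  have [C HC] := interpolated_K_method_norm_equiv ball th q1.
  by exists C; apply: HC => //; exact: L1_norm_le_Linfty.
- move=> eqv; apply: bounded_square_operator => //.
  apply: (dilation_bounded_of_exists_equiv _ _ _ _ eqv) => //.
  + exact: L1_norm_le_Linfty.
  + exact: L1_Linfty_power_dilation.
Qed.
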